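(* Let $\ell\ge5$ be a prime, let $k$ be a positive even integer, let $N$ be a positive integer with $\ell\nmid N$, and let $\psi$ be a Dirichlet character modulo $N$. Let $f_1,\dots,f_s\in S_k(N,\psi)$ be normalized eigenforms such that for each $i\in\{1,\dots,s\}$, $\bar\rho_{f_i}(G_{\mathbb{Q}})$ contains a conjugate of $\mathrm{SL}_2(\mathbb{F}_\ell)$. Then for every $\gamma\in\mathrm{SL}_2(\mathbb{F}_\ell)$ there exists $\sigma\in\mathrm{Gal}(\overline{\mathbb{Q}}/\mathbb{Q}(\zeta_\ell))$ such that for all $i\in\{1,\dots,s\}$ we have either $\bar\rho_{f_i}(\sigma)\sim\gamma$ or $\bar\rho_{f_i}(\sigma)\sim-\gamma$. In particular, for all $i\in\{1,\dots,s\}$ we have $\bar\rho_{f_i}(\sigma^2)\sim\gamma^2$.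
   Context: $G_{\mathbb{Q}}=\mathrm{Gal}(\overline{\mathbb{Q}}/\mathbb{Q})$, and $\zeta_\ell$ is a primitive $\ell$-th root of unity. $S_k(N,\psi)$ is the space of cusp forms of weight $k$ on $\Gamma_0(N)$ with character $\psi$ whose Fourier coefficients are algebraic numbers integral at all primes above $\ell$. A normalized eigenform is a form $f=\sum_{n\ge1}a(n)q^n$ with $a(1)=1$ that is an eigenform of all $T_Q$ ($Q\nmid N$ prime) and $U_Q$ ($Q\mid N$ prime). Fix an embedding $\iota_\ell:\overline{\mathbb{Q}}\hookrightarrow\overline{\mathbb{Q}}_\ell$. For a normalized eigenform $f=\sum a(n)q^n\in S_k(N,\psi)$, $\rho_f:G_{\mathbb{Q}}\to\mathrm{GL}_2(\overline{\mathbb{Q}}_\ell)$ is the unique continuous irreducible representation, unramified at every prime $p\nmid\ell N$, such that $\rho_f(\mathrm{Frob}_p)$ (arithmetic Frobenius) has characteristic polynomial $X^2-\iota_\ell(a(p))X+\iota_\ell(\psi(p))p^{k-1}$ for such $p$; $\bar\rho_f:G_{\mathbb{Q}}\to\mathrm{GL}_2(\overline{\mathbb{F}}_\ell)$ is its semisimple mod $\ell$ reduction. For $A,B\in\mathrm{GL}_2(\overline{\mathbb{F}}_\ell)$, $A\sim B$ means that $A$ and $B$ are conjugate by an element of $\mathrm{GL}_2(\overline{\mathbb{F}}_\ell)$; conjugates of subgroups are also taken in $\mathrm{GL}_2(\overline{\mathbb{F}}_\ell)$. *)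

(* Defs.v *)
From HB Require Import structures.
From mathcomp Require Import all_boot all_order all_fingroup all_algebra all_field.
From mathcomp Require Import complex.
From mathcomp Require Import all_classical all_reals all_analysis.

Set Implicit Arguments.
Unset Strict Implicit.
Unset Printing Implicit Defensive.

Import Order.TTheory GRing.Theory Num.Theory.
Import numFieldNormedType.Exports.

Local Open Scope classical_set_scope.
Local Open Scope ring_scope.

(* The field algC plays the role of Qbar; being a field of algebraic numbers
   without a fixed inclusion in the complex numbers, it is always accompanied
   by an embedding into R[i], over which the main statement quantifies. *)

(* Every ring endomorphism of Qbar is an automorphism (see GQ_bij) and fixes Q,
   so this is the full Galois group, with composition as group law. *)
Definition GQ : Type := {rmorphism algC -> algC}.

Definition GQ1 : GQ := idfun.
Definition GQM (s t : GQ) : GQ := s \o t.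

Lemma GQ_bij (s : GQ) : bijective s.
Proof. by exists (algC_invaut s); [exact: algC_autK|exact: algC_invautK]. Qed.

Definition Qadjoin (z : algC) : set algC :=
  [set (map_poly (ratr : rat -> algC) p).[z] | p in [set: {poly rat}]].

Definition GalOver (K : set algC) : set GQ :=
  [set s | forall x, K x -> s x = x].

(* P is a prime ideal of the ring of all algebraic integers, above p *)
Definition prime_ideal_above (p : nat) (P : set algC) : Prop :=
  [/\ (forall x, P x -> x \in Aint) /\ P p%:R,
      forall x y, P x -> P y -> P (x + y),
      forall x y, x \in Aint -> P y -> P (x * y),
      ~ P 1
    & forall x y, x \in Aint -> y \in Aint -> P (x * y) -> P x \/ P y].

Definition integral_at (P : set algC) (x : algC) : Prop :=
  exists b c : algC, [/\ b \in Aint, c \in Aint, ~ P c & x = b / c].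

Definition decomposition (P : set algC) : set GQ :=
  [set s | forall x, P (s x) <-> P x].

Definition inertia (P : set algC) : set GQ :=
  [set s | decomposition P s /\ forall x, x \in Aint -> P (s x - x)].

(* arithmetic Frobenius elements at P, for P above p *)
Definition frobenius (p : nat) (P : set algC) : set GQ :=
  [set s | decomposition P s /\ forall x, x \in Aint -> P (s x - x ^+ p)].

(* The values at integers prime to N are then automatically roots of unity. *)
Definition dirichlet_character (N : nat) (psi : int -> algC) : Prop :=
  [/\ psi 1 = 1,
      forall m n, psi (m * n) = psi m * psi n,
      forall m, psi (m + N%:Z) = psi m
    & forall m, (psi m != 0) = coprimez m N%:Z].

Section ModularForms.
Variable R : realType.
Implicit Types (f : R[i] -> R[i]) (z : R[i]) (g : 'M[int]_2).

Definition upper_half : set R[i] := [set z | 0 < complex.Im z].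

Definition cexp z : R[i] :=
  Complex (expR (complex.Re z) * cos (complex.Im z))
          (expR (complex.Re z) * sin (complex.Im z)).

Definition holomorphic_on_H f : Prop :=
  forall z, upper_half z -> derivable (f : R[i]^o -> R[i]^o) z 1.

Definition moebius g z : R[i] :=
  ((g 0 0)%:~R * z + (g 0 1)%:~R) / ((g 1 0)%:~R * z + (g 1 1)%:~R).

Definition slash (k : nat) f g z : R[i] :=
  ((g 1 0)%:~R * z + (g 1 1)%:~R) ^- k * f (moebius g z).

(* f z = \sum_(n >= 0) b n * exp (2 pi i n z / h) on the upper half plane *)
Definition fourier_expansion (h : nat) f (b : nat -> R[i]) : Prop :=
  forall z, upper_half z ->
    (fun m : nat => \sum_(0 <= n < m)
       b n * cexp (Complex 0 (2 * pi) * n%:R * z / h%:R) : R[i]^o)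
    @ \oo --> (f z : R[i]^o).

Definition SL2Z : set 'M[int]_2 := [set g | \det g = 1].
Definition Gamma0 (N : nat) : set 'M[int]_2 :=
  [set g | \det g = 1 /\ (N%:Z %| g 1%R 0%R)%Z].

(* Every conjugate of Gamma_1(N) in SL_2(Z) contains Gamma(N), hence the
   expansions in exp (2 pi i z / N) at all cusps. *)
Definition cusp_form (k N : nat) (psi : int -> R[i]) f : Prop :=
  [/\ holomorphic_on_H f,
      forall g z, Gamma0 N g -> upper_half z ->
        slash k f g z = psi (g 1 1) * f z
    & forall g, SL2Z g ->
        exists2 b : nat -> R[i], b 0%N = 0 & fourier_expansion N (slash k f g) b].

(* f lies in S_k(N, psi) and has the l-integral algebraic Fourier coefficients
   a n, seen in R[i] through iC *)
Definition in_S (iC : {rmorphism algC -> R[i]}) (l k N : nat)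
    (psi : int -> algC) f (a : nat -> algC) : Prop :=
  [/\ cusp_form k N (iC \o psi) f,
      a 0%N = 0,
      fourier_expansion 1 f (iC \o a)
    & forall P, prime_ideal_above l P -> forall n, integral_at P (a n)].

End ModularForms.

Definition hecke_T (k : nat) (psi : int -> algC) (Q : nat) (a : nat -> algC)
    (n : nat) : algC :=
  a (Q * n)%N
  + psi Q%:Z * Q%:R ^+ k.-1 * (if (Q %| n)%N then a (n %/ Q)%N else 0).

Definition hecke_U (Q : nat) (a : nat -> algC) (n : nat) : algC := a (Q * n)%N.

Definition normalized_eigen (k N : nat) (psi : int -> algC) (a : nat -> algC)
    : Prop :=
  [/\ a 1%N = 1,
      forall Q, prime Q -> ~~ (Q %| N)%N ->
        exists lam : algC, forall n, hecke_T k psi Q a n = lam * a n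
    & forall Q, prime Q -> (Q %| N)%N ->
        exists lam : algC, forall n, hecke_U Q a n = lam * a n].

Definition conj_GL2 (K : fieldType) (A B : 'M[K]_2) : Prop :=
  exists2 g : 'M[K]_2, g \in unitmx & A = g *m B *m invmx g.

Section Representations.
Variable K : fieldType.
Implicit Types r : GQ -> 'M[K]_2.

(* values are invertible matrices by the two identities *)
Definition is_rep r : Prop :=
  r GQ1 = 1%:M /\ forall s t, r (GQM s t) = r s *m r t.

(* The space of column vectors u^T, for u in the row space of U, is stable. *)
Definition stable_cols r (U : 'M[K]_2) : Prop :=
  forall s, (U *m (r s)^T <= U)%MS.

Definition irreducible_rep r : Prop :=
  forall U, stable_cols r U -> U = 0 \/ row_full U.

Definition conj_rep r r' : Prop :=
  exists2 h : 'M[K]_2, h \in unitmx & forall s, r' s = h *m r s *m invmx h.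

(* r' is the direct sum of the Jordan-Hoelder factors of r: either r is
   irreducible, or it has a stable line, with quotient a line. *)
Definition semisimplification r r' : Prop :=
  (irreducible_rep r /\ conj_rep r r') \/
  (exists r0, [/\ conj_rep r r0,
                  forall s, r0 s 1 0 = 0
                & conj_rep (fun s => \matrix_(i, j) (r0 s i j *+ (i == j))) r']).

End Representations.

(* A model of Qlbar with its absolute value. Ql is the closure of Q; together
   with completeness, these axioms determine (L, abs) up to isomorphism. *)
Section LAdic.
Variables (R : realType) (l : nat) (L : closedFieldType) (abs : L -> R).

Definition rat_cauchy (u : nat -> rat) : Prop :=
  forall e : R, 0 < e -> exists n0 : nat, forall m n,
    (n0 <= m)%N -> (n0 <= n)%N -> abs (ratr (u m) - ratr (u n)) < e.

Definition rat_cvg (u : nat -> rat) (x : L) : Prop :=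
  forall e : R, 0 < e -> exists n0 : nat, forall n,
    (n0 <= n)%N -> abs (ratr (u n) - x) < e.

Definition Ql : set L := [set x | exists u, rat_cvg u x].

Record is_Qlbar : Prop := IsQlbar {
  abs_ge0 : forall x, 0 <= abs x;
  abs_eq0 : forall x, abs x = 0 <-> x = 0;
  absM : forall x y, abs (x * y) = abs x * abs y;
  abs_ultra : forall x y, abs (x + y) <= Num.max (abs x) (abs y);
  abs_l : abs l%:R = l%:R^-1;
  Ql_complete : forall u, rat_cauchy u -> exists x, rat_cvg u x;
  Qlbar_algebraic : forall x, exists p : {poly L},
    [/\ p != 0, forall n, Ql p`_n & root p x] }.

(* The Krull topology on GQ has as basis of neighbourhoods of s the sets of
   automorphisms agreeing with s on a finite set. *)
Definition continuous_rep (r : GQ -> 'M[L]_2) : Prop :=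
  forall (s : GQ) (e : R), 0 < e -> exists X : seq algC, forall t : GQ,
    {in X, t =1 s} -> forall i j, abs (r t i j - r s i j) < e.

(* F is the residue field of L, with reduction map red, relevant only on the
   valuation ring; F is then an algebraic closure of the field with l elements *)
Record is_residue (F : closedFieldType) (red : L -> F) : Prop := IsResidue {
  red1 : red 1 = 1;
  redD : forall x y, abs x <= 1 -> abs y <= 1 -> red (x + y) = red x + red y;
  redM : forall x y, abs x <= 1 -> abs y <= 1 -> red (x * y) = red x * red y;
  red_eq0 : forall x, abs x <= 1 -> (red x = 0 <-> abs x < 1);
  red_surj : forall y : F, exists2 x, abs x <= 1 & red x = y }.

Definition ss_reduction (F : closedFieldType) (red : L -> F)
    (r : GQ -> 'M[L]_2) (rbar : GQ -> 'M[F]_2) : Prop :=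
  exists r0, [/\ conj_rep r r0,
                 forall s i j, abs (r0 s i j) <= 1
               & semisimplification (fun s => map_mx red (r0 s)) rbar].

(* r is the representation attached to the eigenform of level N, weight k and
   character psi with Fourier coefficients a *)
Definition attached_rep (iota : {rmorphism algC -> L}) (k N : nat)
    (psi : int -> algC) (a : nat -> algC) (r : GQ -> 'M[L]_2) : Prop :=
  [/\ is_rep r, continuous_rep r, irreducible_rep r
    & forall p, prime p -> ~~ (p %| l * N)%N -> forall P, prime_ideal_above p P ->
        (forall s, inertia P s -> r s = 1%:M) /\
        (forall s, frobenius p P s ->
           char_poly (r s) =
             'X^2 - (iota (a p))%:P * 'X + (iota (psi p%:Z) * p%:R ^+ k.-1)%:P)].

End LAdic.

(* the embedding of matrices over the prime field, when F has characteristic l *)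
Definition Fl_mx (l : nat) (F : fieldType) (A : 'M['F_l]_2) : 'M[F]_2 :=
  map_mx (fun x : 'F_l => (x : nat)%:R) A.

Definition image_contains_conj_SL2 (l : nat) (F : fieldType)
    (r : GQ -> 'M[F]_2) : Prop :=
  exists2 g : 'M[F]_2, g \in unitmx & forall A : 'M['F_l]_2, \det A = 1 ->
    exists s, r s = g *m Fl_mx F A *m invmx g.

(* Main.v *)
Require Import Defs.
From mathcomp Require Import all_boot all_order all_fingroup all_algebra.
From mathcomp Require Import all_solvable all_field all_character.
From mathcomp Require Import ring.

(** The idea is that the joint image of the Galois group in the product of the
PGL_2 behaves like a subgroup of a product of simple groups, so that by
Goursat's argument the only obstruction to choosing the components of sigma
independently is the coincidence of projective kernels; and where projective
kernels coincide, the isomorphism between the two images respects the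
conjugacy class of gamma, because the latter can be described by relations.

Arithmetic enters only through a reduction to finite groups. Continuity of the
l-adic representations makes all residual representations factor through one
finite quotient of the Galois group ([reduction_finite], [finite_quotient]).
The element sigma is looked for in the derived subgroup: it then fixes the
l-th roots of unity ([der_fixes_root]) and has determinant 1 in all the
representations. So what has to be shown is [common_element]: if finitely many
degree 2 representations [r i], in characteristic l >= 5, of a finite group G
have images containing conjugates of SL_2(F_l), then for every gamma in
SL_2(F_l) some x in G' has [r i x] conjugate to gamma or -gamma for all i. As
SL_2(F_l) is perfect ([contains_SL2_der]), G may be replaced with the last
term of its derived series, that is, G may be assumed perfect.

Let K_i be the group of the elements of G that [r i] maps to scalars, that is,
to 1 or -1. Instead of Dickson's classification of the subgroups of
PGL_2(q), the proof uses the following dichotomy ([normal_dichotomy]): a normal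
subgroup M of G is either contained in K_i or covers the whole image of [r i].
- If the image of M contains no nontrivial unipotent, take a unipotent u in the
  image of SL_2(F_l) and a conjugate v of u under M. Modulo M, u^a v^b equals
  u^(a + b); hence, when l does not divide a + b, it has order divisible by l,
  and so has trace 2 or -2. This trace is 2 + a b c with
  c = tr ((u - 1) (v - 1)), and comparing (a, b) = (1, 1) and (1, 2) gives c = 0
  for l >= 5. So M preserves the fixed line of u, for all such u, and is
  scalar.
- Otherwise let P be a Sylow l-subgroup of M. Its image fixes a unique line, so
  its normaliser is triangular; by the Frattini argument the image of G is
  that of M times a solvable group, and G is perfect.
It follows that two kernels K_i and K_j are equal or satisfy K_i K_j = G
([rcenter_compare]); by perfectness a kernel K_i different from all K_j, j in J,
then satisfies K_i (\bigcap_j K_j) = G ([perfect_cap], [common_scalars]). This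
allows to adjust the image of x under [r i] without changing its images under
the [r j], except for sign.

When K_i = K_j ([transfer_conj]), choose u and v in G with images the standard
unipotent generators of SL_2(F_l) under [r i]. They satisfy the braid relation
u v u = v u v modulo K_i, their l-th powers are in K_i, and u, v, u v^-1 are
not. The same then holds under [r j]: up to sign, u and v are mapped to
distinct nontrivial unipotents satisfying the braid relation, and such a pair
is conjugate to the standard one ([braid_standard]). Since the standard pair
generates SL_2(F_l) ([SL2_gen]), an element mapped to a conjugate of gamma by
[r i] is also mapped to a conjugate of gamma by [r j], up to sign. *)

Set Implicit Arguments.
Unset Strict Implicit.
Unset Printing Implicit Defensive.
Import Order.TTheory GRing.Theory Num.Theory.
Local Open Scope ring_scope.

(** * Two by two matrices *)

(** Explicit entries reduce matrix identities to [ring] on coefficients. *)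
Definition mat2 (K : Type) (a b c d : K) : 'M[K]_2 :=
  \matrix_(i, j) if i == 0 then if j == 0 then a else b
                 else if j == 0 then c else d.

Lemma mat2_eta (K : Type) (A : 'M[K]_2) :
  A = mat2 (A 0 0) (A 0 1) (A 1 0) (A 1 1).
Proof.
apply/matrixP=> -[[|[|i]] // i2] [[|[|j]] // j2]; rewrite mxE /=;
  by congr (A _ _); apply: val_inj.
Qed.

Section Mat2.
Variable K : fieldType.
Implicit Types (A B g h u v : 'M[K]_2) (a b c d x y : K).

Lemma mat2_inj a b c d a' b' c' d' :
  mat2 a b c d = mat2 a' b' c' d' -> [/\ a = a', b = b', c = c' & d = d'].
Proof.
move=> /matrixP eqM; split.
- by move: (eqM 0 0); rewrite !mxE.
- by move: (eqM 0 1); rewrite !mxE.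
- by move: (eqM 1 0); rewrite !mxE.
- by move: (eqM 1 1); rewrite !mxE.
Qed.

Lemma mat2M a b c d a' b' c' d' :
  mat2 a b c d * mat2 a' b' c' d' =
  mat2 (a * a' + b * c') (a * b' + b * d') (c * a' + d * c') (c * b' + d * d').
Proof.
rewrite [LHS]mat2_eta; congr mat2; rewrite /GRing.mul /= !mxE !big_ord_recl;
by rewrite big_ord0 !mxE /= addr0.
Qed.

Lemma mat2D a b c d a' b' c' d' :
  mat2 a b c d + mat2 a' b' c' d' = mat2 (a + a') (b + b') (c + c') (d + d').
Proof. by rewrite [LHS]mat2_eta !mxE. Qed.

Lemma mat2N a b c d : - mat2 a b c d = mat2 (- a) (- b) (- c) (- d).
Proof. by rewrite [LHS]mat2_eta !mxE. Qed.

Lemma mat2Z x a b c d : x *: mat2 a b c d = mat2 (x * a) (x * b) (x * c) (x * d).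
Proof. by rewrite [LHS]mat2_eta !mxE. Qed.

Lemma mat2_scalar x : x%:M = mat2 x 0 0 x.
Proof. by rewrite [LHS]mat2_eta !mxE. Qed.

Lemma mat2_1 : 1 = mat2 1 0 0 1 :> 'M[K]_2.
Proof. exact: mat2_scalar. Qed.

Lemma mat2_0 : 0 = mat2 0 0 0 0 :> 'M[K]_2.
Proof. by rewrite [LHS]mat2_eta !mxE. Qed.

Lemma det_mat2 a b c d : \det (mat2 a b c d) = a * d - b * c.
Proof.
rewrite (expand_det_row _ 0) !big_ord_recl big_ord0 /cofactor !det_mx11 !mxE /=.
rewrite /bump /= expr0 expr1; ring.
Qed.

Lemma trace_mat2 a b c d : \tr (mat2 a b c d) = a + d.
Proof. by rewrite /mxtrace !big_ord_recl big_ord0 !mxE /= addr0. Qed.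

Definition mat2E :=
  (mat2_1, mat2_0, mat2_scalar, mat2M, mat2D, mat2N, mat2Z, det_mat2, trace_mat2).

Lemma unit_detE A : (A \is a GRing.unit) = (\det A != 0).
Proof. by rewrite -unitfE -unitmxE. Qed.

Lemma conj_eq0 h A : h \is a GRing.unit -> (h * A * h^-1 == 0) = (A == 0).
Proof.
move=> hu; apply/eqP/eqP=> [e|->]; last by rewrite mulr0 mul0r.
by apply: (mulrI hu); apply: (mulIr (x := h^-1)); rewrite ?unitrV // e mulr0 mul0r.
Qed.

Lemma conjM h A B : h \is a GRing.unit ->
  (h * A * h^-1) * (h * B * h^-1) = h * (A * B) * h^-1.
Proof. by move=> hu; rewrite !mulrA mulrVK. Qed.

Lemma conj1 h : h \is a GRing.unit -> h * 1 * h^-1 = 1.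
Proof. by move=> hu; rewrite mulr1 divrr. Qed.

Lemma conjN h A : h * - A * h^-1 = - (h * A * h^-1).
Proof. by rewrite mulrN mulNr. Qed.

Lemma conjZ h x A : h * (x *: A) * h^-1 = x *: (h * A * h^-1).
Proof. by rewrite -scalerAr -scalerAl. Qed.

Lemma tr_conj h A : h \is a GRing.unit -> \tr (h * A * h^-1) = \tr A.
Proof. by move=> hu; rewrite [LHS]mxtrace_mulC !mulmxE mulrA mulVr // mul1r. Qed.

Lemma det_conj h A : h \is a GRing.unit -> \det (h * A * h^-1) = \det A.
Proof.
move=> hu; rewrite !detM mulrC mulrA -detM mulVr //.
by rewrite det1 mul1r.
Qed.

Lemma nilp_entries A : A * A = 0 ->
  [/\ A 1 1 = - A 0 0 & A 0 0 ^+ 2 + A 0 1 * A 1 0 = 0].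
Proof.
rewrite {1 2}[A]mat2_eta mat2E mat2_0.
move: (A 0 0) (A 0 1) (A 1 0) (A 1 1) => a b c d /mat2_inj[e1 e2 e3 e4].
have e : a + d = 0 \/ (b = 0 /\ c = 0).
  have [/eqP e|ne] := boolP (a + d == 0); first by left.
  right; split; apply: (mulfI ne); rewrite mulr0.
    by rewrite -e2; ring.
  by rewrite -e3; ring.
case: e => [e|[b0 c0]].
  split; first by apply/eqP; rewrite -addr_eq0 addrC e.
  by rewrite -e1; ring.
move: e1 e4; rewrite b0 c0 !(mul0r, mulr0) addr0 add0r => /eqP + /eqP.
rewrite !mulf_eq0 !orbb => /eqP-> /eqP->.
by rewrite oppr0 mul0r.
Qed.

Lemma nilp_trace A : A * A = 0 -> \tr A = 0.
Proof.
by move=> A2; have [e _] := nilp_entries A2; rewrite [A]mat2_eta e trace_mat2 subrr.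
Qed.

(** The basis is [A w], [w], for a vector [w] outside the kernel of [A]. *)
Lemma nilp_normal A : A != 0 -> A * A = 0 ->
  exists2 h, h \is a GRing.unit & A = h * mat2 0 1 0 0 * h^-1.
Proof.
move=> An0 /nilp_entries[].
have nz : [|| A 0 0 != 0, A 0 1 != 0, A 1 0 != 0 | A 1 1 != 0].
  apply: contraNT An0; rewrite !negb_or !negbK => /and4P[/eqP a /eqP b /eqP c /eqP d].
  by rewrite [A]mat2_eta a b c d mat2_0.
move: (A 0 0) (A 0 1) (A 1 0) (A 1 1) nz (mat2_eta A) => a b c d nz -> dE e.
rewrite {}dE in nz *.
suff [h hu e'] : exists2 h, h \is a GRing.unit & mat2 a b c (- a) * h = h * mat2 0 1 0 0.
  by exists h => //; rewrite -e' mulrK.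
have [b0|bn0] := eqVneq b 0.
  move: e; rewrite b0 mul0r addr0 => /eqP; rewrite expf_eq0 /= => /eqP a0.
  exists (mat2 0 1 c 0); last by rewrite !mat2E a0; congr mat2; ring.
  move: nz; rewrite a0 b0 oppr0 eqxx /= orbF => cn0.
  by rewrite unit_detE det_mat2 mul0r sub0r mul1r oppr_eq0.
exists (mat2 b 0 (- a) 1).
  by rewrite unit_detE det_mat2 mul0r subr0 mulr1.
rewrite !mat2E; congr mat2; try ring.
by transitivity (a ^+ 2 + b * c); [ring|rewrite e; ring].
Qed.

(** The bilinear invariant [\tr (A * B)] is the entry of [B] that tells whether
[B] kills the kernel of [A] once [A] is in normal form. *)
Lemma nilp_pair A B : A != 0 -> A * A = 0 -> B * B = 0 ->
  exists2 h, h \is a GRing.unit & exists a b c,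
    [/\ A = h * mat2 0 1 0 0 * h^-1, B = h * mat2 a b c (- a) * h^-1,
        a ^+ 2 + b * c = 0 & \tr (A * B) = c].
Proof.
move=> An0 A2 B2; have [h hu defA] := nilp_normal An0 A2.
pose B' := h^-1 * B * h.
have defB : B = h * B' * h^-1 by rewrite /B' !mulrA divrr // mul1r mulrK.
have B'2 : B' * B' = 0.
  by rewrite /B' !mulrA mulrK // -(mulrA _ B B) B2 mulr0 mul0r.
have [d e] := nilp_entries B'2.
exists h => //; exists (B' 0 0), (B' 0 1), (B' 1 0); split=> //.
  by rewrite {1}defB {1}[B']mat2_eta d.
rewrite {1}defA {1}defB conjM // tr_conj // {1}[B']mat2_eta !mat2E; ring.
Qed.

Lemma nilp_collinear A B : A != 0 -> A * A = 0 -> B * B = 0 ->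
  \tr (A * B) = 0 -> exists b, B = b *: A.
Proof.
move=> An0 A2 B2 t0; have [h hu [a [b [c [eA eB e t]]]]] := nilp_pair An0 A2 B2.
move: e eB; rewrite -t t0 mulr0 addr0 => /eqP; rewrite expf_eq0 /= => /eqP-> eB.
exists b; rewrite eA eB -conjZ; congr (_ * _ * _).
by rewrite !mat2E; congr mat2; ring.
Qed.

(** If the kernels of [A] and [B] differ, a basis adapted to both can be chosen. *)
Lemma nilp_opposite A B : A * A = 0 -> B * B = 0 -> \tr (A * B) != 0 ->
  exists2 h, h \is a GRing.unit &
    A = h * mat2 0 1 0 0 * h^-1 /\ B = h * mat2 0 0 (\tr (A * B)) 0 * h^-1.
Proof.
move=> A2 B2 tn0.
have An0 : A != 0 by apply: contraNneq tn0 => ->; rewrite mul0r mxtrace0.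
have [h hu [a [b [c [eA eB e t]]]]] := nilp_pair An0 A2 B2.
rewrite t in tn0 *; pose x := a / c.
have xu : mat2 1 x 0 1 \is a GRing.unit.
  by rewrite unit_detE det_mat2 mulr1 mulr0 subr0 oner_eq0.
have xV : (mat2 1 x 0 1)^-1 = mat2 1 (- x) 0 1.
  apply: (mulrI xu); rewrite divrr // !mat2E; congr mat2; ring.
exists (h * mat2 1 x 0 1); first by rewrite unitrMl.
rewrite invrM // xV; split.
  rewrite {1}eA !mulrA; congr (_ * _); rewrite -!mulrA; congr (_ * _).
  by rewrite !mat2E; congr mat2; ring.
rewrite {1}eB !mulrA; congr (_ * _); rewrite -!mulrA; congr (_ * _).
have eb : b = - (a ^+ 2 / c).
  apply: (mulIf tn0); rewrite mulNr divfK //.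
  by apply/eqP; rewrite -addr_eq0 addrC e.
by rewrite eb /x !mat2E; congr mat2; field.
Qed.

(** Matrices commuting with a Jordan block are of the form [a + b A], and so
have a double eigenvalue; the conclusion is the vanishing of the discriminant. *)
Lemma centralizes_nilp g A : A != 0 -> A * A = 0 -> g * A = A * g ->
  \tr g ^+ 2 = (\det g) *+ 4.
Proof.
move=> An0 A2 gA; have [h hu eA] := nilp_normal An0 A2.
have [g' eg] : exists g', g = h * g' * h^-1.
  by exists (h^-1 * g * h); rewrite !mulrA divrr // mul1r mulrK.
have : g' * mat2 0 1 0 0 = mat2 0 1 0 0 * g'.
  apply: (mulrI hu); apply: (mulIr (x := h^-1)); rewrite ?unitrV //.
  by rewrite -!conjM // -eA -eg gA.
rewrite eg tr_conj // det_conj //; rewrite [g']mat2_eta !mat2E.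
move: (g' 0 0) (g' 0 1) (g' 1 0) (g' 1 1) => a b c d /mat2_inj[].
rewrite !(mul0r, mulr0, mulr1, mul1r, addr0, add0r) => <- -> _ _.
ring.
Qed.

(** By Cayley-Hamilton, with the determinant of [A] being zero, [A * A] is
[\tr A *: A]. *)
Lemma nilp_sqr0 A n : A ^+ n = 0 -> A * A = 0.
Proof.
move=> An.
have nn : (0 < n)%N by case: n An => // /eqP; rewrite expr0 oner_eq0.
have d0 : \det A = 0.
  have : \det (A ^+ n) = \det A ^+ n.
    elim: (n) => [|m IH]; first by rewrite !expr0 det1.
    by rewrite !exprS detM IH.
  by rewrite An det0 => /esym/eqP; rewrite expf_eq0 => /andP[_ /eqP].
have CH : A * A = \tr A *: A.
  move: d0; rewrite [A]mat2_eta !mat2E.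
  move: (A 0 0) (A 0 1) (A 1 0) (A 1 1) => a b c d /eqP; rewrite subr_eq0 => /eqP e.
  by congr mat2; try ring; rewrite mulrDl ?(mulrC d a) e; ring.
have Apow m : A ^+ m.+1 = \tr A ^+ m *: A.
  elim: m => [|m IH]; first by rewrite expr1 expr0 scale1r.
  by rewrite exprS IH -scalerAr CH scalerA -exprSr.
move: An; rewrite -(prednK nn) Apow => /eqP; rewrite scaler_eq0.
case/orP=> [|/eqP->]; last by rewrite mul0r.
by rewrite expf_eq0 => /andP[_ /eqP t0]; rewrite CH t0 scale0r.
Qed.

Lemma unip_exp A n : A * A = 0 -> (1 + A) ^+ n = 1 + A *+ n.
Proof.
move=> A2; elim: n => [|n IH]; first by rewrite expr0 mulr0n addr0.
by rewrite exprS IH mulrDl mul1r mulrDr mulr1 mulrnAr A2 mul0rn addr0 -addrA -mulrSr.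
Qed.

Section Char.
Variables (l : nat) (lch : l \in [pchar K]).
Lemma pchar_mat2 : l \in [pchar 'M[K]_2].
Proof.
case/andP: lch => lp /eqP l0; apply/andP; split=> //; apply/eqP.
by rewrite -(@scaler_nat _ 'M[K]_2) l0 scale0r.
Qed.

(** The Frobenius identity [(g - 1) ^+ l = g ^+ l - 1] makes [g - 1] nilpotent. *)
Lemma unip_of_pow_char g : g ^+ l = 1 -> (g - 1) * (g - 1) = 0.
Proof.
move=> gl; apply: (@nilp_sqr0 _ l).
have := pFrobenius_autB_comm pchar_mat2 (commr1 g).
by rewrite !pFrobenius_autE gl expr1n subrr.
Qed.

(** Matrices of finite order with distinct eigenvalues have order prime to [l]:
the power [g ^+ m] is unipotent, and a nontrivial unipotent commutes only with
matrices of discriminant zero. *)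
Lemma pow_char_eq1 g m : \tr g ^+ 2 != (\det g) *+ 4 -> g ^+ (m * l) = 1 -> g ^+ m = 1.
Proof.
move=> tn e; rewrite exprM in e; have A2 := unip_of_pow_char e.
apply/eqP; rewrite -subr_eq0; apply: contraNT tn => An0; apply/eqP.
apply: (centralizes_nilp An0 A2).
by rewrite mulrBr mulrBl mulr1 mul1r -exprS -exprSr.
Qed.
End Char.

End Mat2.

(** * Standard generators of SL_2 and the braid relation *)

Section Generators.
Variable K : fieldType.
Implicit Types (A B g h u v : 'M[K]_2) (a b c d x y : K).

Lemma conj_inj h A B : h \is a GRing.unit -> h * A * h^-1 = h * B * h^-1 -> A = B.
Proof.
move=> hu; have hV : h^-1 \is a GRing.unit by rewrite unitrV.
by move/(mulIr hV)/(mulrI hu).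
Qed.

Lemma conj_unip h A : h \is a GRing.unit -> 1 + h * A * h^-1 = h * (1 + A) * h^-1.
Proof. by move=> hu; rewrite mulrDr mulrDl mulr1 divrr. Qed.

Definition elU : 'M[K]_2 := mat2 1 1 0 1.
Definition elL : 'M[K]_2 := mat2 1 0 (-1) 1.

(** A pair of distinct nontrivial unipotents is determined up to conjugation by
[\tr (A * B)], and the braid relation forces this trace to be -1. The
relation up to sign is considered because only images in PGL_2 are compared. *)
Lemma braid_standard A B : (2%:R : K) != 0 -> A != 0 -> A != B ->
    A * A = 0 -> B * B = 0 -> let u := 1 + A in let v := 1 + B in
    u * v * u = v * u * v \/ u * v * u = - (v * u * v) ->
  exists2 h, h \is a GRing.unit & u = h * elU * h^-1 /\ v = h * elL * h^-1.
Proof.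
move=> K2 An0 AB A2 B2 u v; rewrite /u /v.
have ne11 : 1 <> - 1 :> K.
  by move/eqP; rewrite -subr_eq0 opprK -mulr2n (negPf K2).
have [t0|t0] := eqVneq (\tr (A * B)) 0.
  (* Then u and v commute, and the relation reads u = v or u = - v. *)
  have [b eB] := nilp_collinear An0 A2 B2 t0.
  have [h hu eA] := nilp_normal An0 A2.
  rewrite eB eA -conjZ in AB *; rewrite !conj_unip // !conjM // -conjN.
  rewrite !mat2E => -[] /(conj_inj hu)/mat2_inj[e1 e2 _ _]; last first.
    by case: ne11; apply: etrans (etrans _ e1) _; ring.
  case/eqP: AB; rewrite !mat2E; congr (_ * mat2 _ _ _ _ * _); try ring.
  apply: (addIr (1 + b)); apply: etrans (etrans _ e2) _; ring.
have [h hu] := nilp_opposite A2 B2 t0; move: (\tr _) t0 => c cn0 [eA eB].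
rewrite eA eB !conj_unip // !conjM // -conjN => e.
exists h => //; rewrite /elU /elL.
suff ec : c = -1 by rewrite ec !mat2E; split; congr (_ * mat2 _ _ _ _ * _); ring.
move: e; rewrite !mat2E => -[] /(conj_inj hu)/mat2_inj[e1 e2 e3 e4].
  by apply: (addIr (2%:R)); apply: etrans (etrans _ e2) _; ring.
apply: (mulfI K2); apply: (addIr 2%:R).
transitivity ((1 + c) + (1 + c)); first by ring.
transitivity ((1 + c) - (1 + c)); last by ring.
by congr (_ + _); apply: etrans (etrans _ e1) _; ring.
Qed.

Lemma elU_exp n : elU ^+ n = mat2 1 n%:R 0 1.
Proof.
elim: n => [|n IH]; first by rewrite expr0 mat2_1.
by rewrite exprS IH /elU !mat2E -natr1; congr mat2; ring.
Qed.

Lemma elL_exp n : elL ^+ n = mat2 1 0 (- n%:R) 1.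
Proof.
elim: n => [|n IH]; first by rewrite expr0 mat2_1 oppr0.
by rewrite exprS IH /elL !mat2E -natr1; congr mat2; ring.
Qed.

(** Every element of a prime field being a positive multiple of 1, all elementary
matrices are positive powers of [elU] or [elL]. A matrix with nonzero lower left
entry is a product of three elementary ones; multiply by a lower one to reduce
to this case. *)
Lemma SL2_gen (P : 'M[K]_2 -> Prop) :
    (forall x : K, exists n : nat, x = n.+1%:R) ->
    (forall g h, P g -> P h -> P (g * h)) -> P elU -> P elL ->
  forall g, \det g = 1 -> P g.
Proof.
move=> Kn PM PU PL.
have Pexp g n : P g -> P (g ^+ n.+1).
  by move=> Pg; elim: n => [|n IH]; rewrite ?expr1 // exprS; apply: PM.
have PUx x : P (mat2 1 x 0 1).
  by have [n ->] := Kn x; rewrite -elU_exp; apply: Pexp.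
have PLx x : P (mat2 1 0 x 1).
  by rewrite -[x]opprK; have [n ->] := Kn (- x); rewrite -elL_exp; apply: Pexp.
have Pc a b c d : c != 0 -> a * d - b * c = 1 -> P (mat2 a b c d).
  move=> c0 e; have -> : mat2 a b c d =
      mat2 1 ((a - 1) / c) 0 1 * mat2 1 0 c 1 * mat2 1 ((d - 1) / c) 0 1.
    have -> : b = (a * d - 1) / c by apply: (mulIf c0); rewrite divfK // -e; ring.
    by rewrite !mat2E; congr mat2; field.
  by apply: (PM); first apply: (PM).
move=> g; rewrite [g]mat2_eta !mat2E.
move: (g 0 0) (g 0 1) (g 1 0) (g 1 1) => a b c d e.
have [c0|c0] := eqVneq c 0; last exact: Pc.
have -> : mat2 a b c d = mat2 (a - b) b (c - d) d * mat2 1 0 1 1.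
  by rewrite !mat2E; congr mat2; ring.
apply: PM => //; apply: Pc; last by rewrite -e; ring.
rewrite c0 sub0r oppr_eq0; apply/eqP => d0; move: e; rewrite c0 d0 => /eqP.
by rewrite !mulr0 subr0 eq_sym oner_eq0.
Qed.

(** The reason why SL_2 is perfect: conjugation by the diagonal matrix with
entries [t] and [t^-1] multiplies the parameter of an upper unipotent by
[t ^+ 2], so that its commutators with upper unipotents multiply it by
[t ^+ 2 - 1]. *)
Lemma elU_comm (t : K) : t != 0 -> t ^+ 2 != 1 ->
  exists g h, [/\ \det g = 1, \det h = 1 & g * h = elU * (h * g)].
Proof.
move=> t0 t1; have t1' : t ^+2 - 1 != 0 by rewrite subr_eq0.
exists (mat2 t 0 0 t^-1), (mat2 1 ((t ^+ 2 - 1)^-1) 0 1).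
split; first by rewrite det_mat2 mulr0 subr0 divff.
  by rewrite det_mat2 mulr0 subr0 mulr1.
by rewrite /elU !mat2E; congr mat2; field; rewrite ?t0 ?t1'.
Qed.

Lemma elL_comm (t : K) : t != 0 -> t ^+ 2 != 1 ->
  exists g h, [/\ \det g = 1, \det h = 1 & g * h = elL * (h * g)].
Proof.
move=> t0 t1; have t1' : t ^+2 - 1 != 0 by rewrite subr_eq0.
exists (mat2 t^-1 0 0 t), (mat2 1 0 (- (t ^+ 2 - 1)^-1) 1).
split; first by rewrite det_mat2 mulr0 subr0 mulVf.
  by rewrite det_mat2 mul0r subr0 mulr1.
by rewrite /elL !mat2E; congr mat2; field; rewrite ?t0 ?t1'.
Qed.

End Generators.

(** * Matrices over the prime field *)

Lemma map_mat2 (K L : Type) (f : K -> L) a b c d :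
  map_mx f (mat2 a b c d) = mat2 (f a) (f b) (f c) (f d).
Proof. by rewrite [LHS]mat2_eta !mxE. Qed.

Section PrimeField.
Variables (l : nat) (F : fieldType).
Hypotheses (l_prime : prime l) (lch : l \in [pchar F]).

Definition Fl_emb (x : 'F_l) : F := (x : nat)%:R.

Lemma Fl_emb_nat (n : nat) : Fl_emb n%:R = n%:R.
Proof.
by rewrite /Fl_emb Zp_nat /= (Fp_cast l_prime) (GRing.natr_mod_pchar lch).
Qed.

(** Writing elements as positive multiples of 1 reduces the compatibility of
[Fl_emb] with the operations to that of [%:R]. *)
Lemma Fl_natr (x : 'F_l) : exists n, x = n.+1%:R.
Proof.
exists (x + l.-1)%N; rewrite -addnS prednK ?prime_gt0 // natrD natr_Zp.
by rewrite pchar_Fp_0 // addr0.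
Qed.

Lemma Fl_embD x y : Fl_emb (x + y) = Fl_emb x + Fl_emb y.
Proof.
have [m ->] := Fl_natr x; have [n ->] := Fl_natr y.
by rewrite -natrD !Fl_emb_nat natrD.
Qed.

Lemma Fl_embM x y : Fl_emb (x * y) = Fl_emb x * Fl_emb y.
Proof.
have [m ->] := Fl_natr x; have [n ->] := Fl_natr y.
by rewrite -natrM !Fl_emb_nat natrM.
Qed.

Lemma Fl_embN x : Fl_emb (- x) = - Fl_emb x.
Proof.
by apply: (addIr (Fl_emb x)); rewrite -Fl_embD !addNr (Fl_emb_nat 0).
Qed.

Lemma Fl_mx_mat2 a b c d :
  Fl_mx F (mat2 a b c d) = mat2 (Fl_emb a) (Fl_emb b) (Fl_emb c) (Fl_emb d).
Proof. exact: map_mat2. Qed.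

Lemma Fl_mxM (A B : 'M['F_l]_2) : Fl_mx F (A * B) = Fl_mx F A * Fl_mx F B.
Proof.
by rewrite [A]mat2_eta [B]mat2_eta mat2M !Fl_mx_mat2 mat2M !Fl_embD !Fl_embM.
Qed.

Lemma Fl_mx_elU : Fl_mx F (elU 'F_l) = elU F.
Proof. by rewrite Fl_mx_mat2 (Fl_emb_nat 0) (Fl_emb_nat 1). Qed.

Lemma Fl_mx_elL : Fl_mx F (elL 'F_l) = elL F.
Proof. by rewrite Fl_mx_mat2 Fl_embN (Fl_emb_nat 0) (Fl_emb_nat 1). Qed.

End PrimeField.

(** * Normal subgroups of a perfect group with large image *)

Section Rep.
Variables (l : nat) (F : fieldType).
Hypotheses (l_prime : prime l) (l_ge5 : (5 <= l)%N) (lch : l \in [pchar F]).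
Variables (gT : finGroupType) (G : {group gT}).
Implicit Types (rG : mx_representation F G 2) (M : {group gT}).

Lemma natr_pchar_neq0 n : (0 < n < 5)%N -> (n%:R : F) != 0.
Proof.
case/andP=> n0 n5; rewrite -(dvdn_pcharf lch) gtnNdvd //.
exact: leq_trans n5 l_ge5.
Qed.

(** The conjugating matrix is an argument, since comparing representations
requires keeping track of it. *)
Definition contains_SL2 rG (h : 'M[F]_2) :=
  forall A : 'M['F_l]_2, \det A = 1 ->
    exists2 x, x \in G & rG x = h * Fl_mx F A * h^-1.

Section Single.
Variable rG : mx_representation F G 2.

Lemma rgM x y : x \in G -> y \in G -> rG (x * y)%g = rG x * rG y.
Proof. exact: repr_mxM. Qed.
Lemma rgV x : x \in G -> rG x^-1%g = (rG x)^-1.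
Proof. exact: repr_mxV. Qed.
Lemma rgX x n : x \in G -> rG (x ^+ n)%g = rG x ^+ n.
Proof. by move=> Gx; rewrite repr_mxX. Qed.
Lemma rg1 : rG 1%g = 1.
Proof. exact: repr_mx1. Qed.
Lemma rgU x : x \in G -> rG x \is a GRing.unit.
Proof. exact: repr_mx_unit. Qed.

Lemma rgJ x y : x \in G -> y \in G -> rG (x ^ y)%g = (rG y)^-1 * rG x * rG y.
Proof. by move=> Gx Gy; rewrite conjgE !rgM ?rgV ?groupM ?groupV // mulrA. Qed.

Lemma rg_comm x y : x \in G -> y \in G ->
  rG x * rG y = rG y * rG x * rG [~ x, y]%g.
Proof.
by move=> Gx Gy; rewrite -!rgM ?groupR ?groupM // commgC.
Qed.

Lemma rker_repr x : (x \in rker rG) = (x \in G) && (rG x == 1).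
Proof. by rewrite inE mul1mx. Qed.

Lemma det_der x : x \in G^`(1)%g -> \det (rG x) = 1.
Proof.
pose D := [set x in G | \det (rG x) == 1].
have gD : group_set D.
  apply/group_setP; split; first by rewrite inE group1 rg1 det1 eqxx.
  move=> a b /setIdP[Ga /eqP da] /setIdP[Gb /eqP db].
  by rewrite inE groupM // rgM // detM da db mulr1 eqxx.
suff /subsetP sD : G^`(1)%g \subset Group gD by move/sD/setIdP=> [_ /eqP].
rewrite derg1 gen_subG; apply/subsetP=> _ /imset2P[a b Ga Gb ->].
rewrite inE groupR //=; apply/eqP.
have u0 : \det (rG b * rG a) != 0.
  by rewrite detM mulf_neq0 // -unit_detE rgU.
apply: (mulfI u0); rewrite -detM -rg_comm // mulr1.
by rewrite !detM mulrC.
Qed.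

Hypothesis perfG : (G^`(1) = G)%g.

Lemma det_perfect x : x \in G -> \det (rG x) = 1.
Proof. by rewrite -{1}perfG; apply: det_der. Qed.

(** The determinant being 1, scalars in the image are square roots of 1. *)
Lemma rcenter_perfect x : (x \in rcenter rG) = (x \in G) && ((rG x == 1) || (rG x == -1)).
Proof.
rewrite inE; have [Gx|//] := boolP (x \in G); rewrite /=.
apply/is_scalar_mxP/orP => [[a ea]|[/eqP->|/eqP->]].
- move: (det_perfect Gx); rewrite ea det_scalar => /eqP.
  rewrite -[X in _ == X](expr1n _ 2) eqf_sqr => /orP[/eqP->|/eqP->]; first by left.
  by right; apply/eqP; rewrite -[RHS]/(- 1%:M) -raddfN.
- by exists 1.
- by exists (-1); rewrite raddfN.
Qed.

Definition unipotent (g : 'M[F]_2) := (g - 1) * (g - 1) == 0.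

(** With [u = rG x] and [v] its conjugate by [rG m], the element [u ^+ a * v ^+ b] is
congruent to [u ^+ (a + b)] modulo [M]. For [a + b] prime to [l] its order is
divisible by [l], lest a power of [u] other than 1 lie in the image of [M]; so
its discriminant, a function of the trace below, vanishes. *)
Lemma trace_conj_eq0 M x m A : (M <| G)%g ->
    {in M, forall y, unipotent (rG y) -> rG y = 1} ->
    x \in G -> rG x = 1 + A -> A * A = 0 -> A != 0 -> m \in M ->
  \tr (A * (rG m * A * (rG m)^-1)) = 0.
Proof.
move=> nM Mnounip Gx ex A2 An0 Mm; have Gm := subsetP (normal_sub nM) _ Mm.
set B := rG m * A * (rG m)^-1; set c := \tr _.
have mu := rgU Gm.
have B2 : B * B = 0 by rewrite /B conjM // A2 mulr0 mul0r.
pose x' := (x ^ m^-1)%g.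
have Gx' : x' \in G by rewrite groupJ ?groupV.
have ex' : rG x' = 1 + B.
  by rewrite rgJ ?groupV // rgV // invrK ex mulrDr mulrDl mulr1 divrr.
(* The discriminant of u ^+ a * v ^+ b is (2 + a b c) ^+ 2 - 4. *)
have key a b : ((a + b)%:R : F) != 0 -> (a * b)%:R * c * (4%:R + (a * b)%:R * c) = 0.
  move=> ab0.
  pose y := (x ^+ a * x' ^+ b)%g; have Gy : y \in G by rewrite groupM ?groupX.
  have ey : rG y = (1 + A *+ a) * (1 + B *+ b).
    by rewrite rgM ?groupX // !rgX // ex ex' !unip_exp.
  have ty : \tr (rG y) = 2%:R + (a * b)%:R * c.
    rewrite ey mulrDl mul1r mulrDr mulr1 !mxtraceD mxtrace1 /=.
    by rewrite mulrnAl mulrnAr -mulrnA !raddfMn /= (nilp_trace A2)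
      (nilp_trace B2) !mul0rn addr0 add0r mulr_natl mulnC.
  have [e|ne] := eqVneq (\tr (rG y) ^+ 2) (\det (rG y) *+ 4).
    move: e; rewrite ty det_perfect // => e.
    apply: etrans (_ : (2%:R + (a * b)%:R * c) ^+ 2 - 4%:R = 0).
      ring.
    by rewrite e subrr.
  (* If it does not vanish, n is a multiple of the order of rG y. *)
  pose n := (#[y]%g`_l^')%N; have pn : (0 < n)%N by apply: part_gt0.
  have yn : rG y ^+ n = 1.
    have : rG y ^+ (n * l ^ logn l #[y]%g) = 1.
      by rewrite -rgX // -p_part mulnC partnC // expg_order rg1.
    elim: (logn _ _) => [|e IH]; first by rewrite expn0 muln1.
    by rewrite expnSr mulnA => /(pow_char_eq1 lch ne)/IH.
  have Mmu : (x ^+ ((a + b) * n) * y ^- n)%g \in M.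
    have nMG := normal_norm nM; have sub := subsetP nMG.
    have Nx := sub _ Gx; have Nm := sub _ Gm; have Ny := sub _ Gy.
    have Nx' := sub _ Gx'.
    apply: coset_idr; first by rewrite groupM ?groupV ?groupX.
    rewrite morphM ?groupX ?groupV ?groupX //= morphV ?groupX //= !morphX //=.
    have cx' : coset M x' = coset M x.
      by rewrite morphJ ?groupV //= (coset_id (groupVr Mm)) conjg1.
    have cy : coset M y = (coset M x ^+ (a + b))%g.
      by rewrite morphM ?groupX //= !morphX //= cx' -expgD.
    by rewrite cy -expgM mulgV.
  have Gmu := subsetP (normal_sub nM) _ Mmu.
  have emu : rG (x ^+ ((a + b) * n) * y ^- n)%g = 1 + A *+ ((a + b) * n).
    by rewrite rgM ?groupV ?groupX // rgV ?groupX // !rgX // yn invr1 mulr1 ex unip_exp.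
  have: A *+ ((a + b) * n) = 0.
    apply: (addrI 1); rewrite -emu addr0; apply: Mnounip => //.
    by rewrite /unipotent emu addrC addKr mulrnAl mulrnAr A2 !mul0rn.
  rewrite -scaler_nat => /eqP; rewrite scaler_eq0 (negPf An0) orbF natrM.
  rewrite mulf_eq0 (negPf ab0) /=.
  rewrite -(dvdn_pcharf lch) => ln; exfalso.
  have := part_pnat (negn l) #[y]%g; rewrite -/n => /(pnatPpi)/(_ (_ : l \in \pi(n))).
  by rewrite !inE mem_primes l_prime pn ln eqxx => /(_ isT).
(* These two choices give c = -4 and c = -2 unless c = 0. *)
have k11 := key 1%N 1%N (natr_pchar_neq0 (isT : 0 < 2 < 5)%N).
have k12 := key 1%N 2%N (natr_pchar_neq0 (isT : 0 < 3 < 5)%N).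
apply/eqP/negPn/negP => c0.
move/eqP: k11; rewrite !mulf_eq0 (negPf c0) oner_eq0 /= mul1r => /eqP e1.
move/eqP: k12; rewrite !mulf_eq0 (negPf c0).
rewrite (negPf (natr_pchar_neq0 (isT : 0 < 2 < 5)%N)) /= => /eqP e2.
have : (4%:R : F) = 0.
  transitivity ((4%:R + 1 * c) *+ 2 - (4%:R + (1 * 2)%:R * c)); first by ring.
  by rewrite e2 mul1r e1 mul0rn subrr.
by apply/eqP; apply: natr_pchar_neq0.
Qed.

(** The trace condition says that [M] preserves the fixed line of each unipotent
in the conjugate of SL_2(F_l). The fixed lines of three of them, generated by
(1, 0), (0, 1) and (1, -1), suffice to force a matrix to be scalar. *)
Lemma unipotent_free_scalar M h : (M <| G)%g ->
    {in M, forall y, unipotent (rG y) -> rG y = 1} ->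
    h \is a GRing.unit -> contains_SL2 rG h -> M \subset rcenter rG.
Proof.
move=> nM Mnounip hu big; apply/subsetP=> m Mm.
have Gm := subsetP (normal_sub nM) _ Mm; have mu := rgU Gm.
have [g eg] : exists g, rG m = h * g * h^-1.
  by exists (h^-1 * rG m * h); rewrite !mulrA divrr // mul1r mulrK.
have gu : \det g != 0 by rewrite -(det_conj g hu) -eg -unit_detE.
have comm (N : 'M[F]_2) (E : 'M['F_l]_2) : N != 0 -> N * N = 0 ->
    \det E = 1 -> Fl_mx F E = 1 + N -> exists b, g * N = b *: (N * g).
  move=> N0 N2 E1 eE; have [x Gx] := big _ E1; rewrite eE -conj_unip // => ex.
  have A0 : h * N * h^-1 != 0 by rewrite conj_eq0.
  have A2 : (h * N * h^-1) * (h * N * h^-1) = 0 by rewrite conjM // N2 mulr0 mul0r.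
  have t0 := trace_conj_eq0 nM Mnounip Gx ex A2 A0 Mm.
  have [|b eb] := nilp_collinear A0 A2 _ t0; first by rewrite conjM // A2 mulr0 mul0r.
  exists b; apply: (conj_inj hu); rewrite -conjM // -eg conjZ -conjM // -eg.
  by rewrite scalerAl -eb mulrVK.
have [b1 e1] : exists b, g * mat2 0 1 0 0 = b *: (mat2 0 1 0 0 * g).
  apply: (comm _ (elU _)).
  - by rewrite mat2_0; apply/eqP => /mat2_inj[_ /eqP]; rewrite oner_eq0.
  - by rewrite !mat2E; congr mat2; ring.
  - by rewrite det_mat2; ring.
  - by rewrite Fl_mx_elU // /elU !mat2E; congr mat2; ring.
have [b2 e2] : exists b, g * mat2 0 0 (-1) 0 = b *: (mat2 0 0 (-1) 0 * g).
  apply: (comm _ (elL _)).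
  - by rewrite mat2_0; apply/eqP => /mat2_inj[_ _ /eqP]; rewrite oppr_eq0 oner_eq0.
  - by rewrite !mat2E; congr mat2; ring.
  - by rewrite det_mat2; ring.
  - by rewrite Fl_mx_elL // /elL !mat2E; congr mat2; ring.
have [b3 e3] : exists b, g * mat2 1 1 (-1) (-1) = b *: (mat2 1 1 (-1) (-1) * g).
  apply: (comm _ (mat2 2%:R 1 (-1) 0)).
  - by rewrite mat2_0; apply/eqP => /mat2_inj[/eqP]; rewrite oner_eq0.
  - by rewrite !mat2E; congr mat2; ring.
  - by rewrite det_mat2; ring.
  - rewrite Fl_mx_mat2 Fl_embN // !(Fl_emb_nat l_prime lch 1) (Fl_emb_nat _ _ 0) //.
    by rewrite (Fl_emb_nat _ _ 2) // !mat2E; congr mat2; ring.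
suff [x ex] : exists x, g = x%:M.
  rewrite inE Gm eg ex; apply/is_scalar_mxP; exists x.
  by rewrite -scalemx1 conjZ conj1.
move: e1 e2 e3 gu; rewrite [g]mat2_eta !mat2E.
move: (g 0 0) (g 0 1) (g 1 0) (g 1 1) => p q r s.
case/mat2_inj=> e1 _ e3 e4 /mat2_inj[e5 _ _ e6] /mat2_inj[e7 e8 _ _] d0.
have r0 : r = 0 by apply: etrans (etrans _ e4) _; ring.
have q0 : q = 0 by apply: oppr_inj; apply: etrans (etrans _ e5) _; ring.
rewrite r0 q0 in e7 e8 d0; rewrite mul0r subr0 mulf_eq0 negb_or in d0.
have [p0 s0] := andP d0.
have b31 : b3 = 1.
  by apply: (mulIf p0); apply: etrans (etrans _ (esym e7)) _; ring.
have -> : s = p by apply/esym; apply: etrans (etrans _ e8) _; rewrite ?b31; ring.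
by exists p; rewrite r0 q0 mat2_scalar.
Qed.

Lemma unip_elt z : z \in G -> (l.-elt z)%g -> unipotent (rG z).
Proof.
move=> Gz /p_natP[e oz]; have z1 : rG z ^+ (l ^ e) = 1.
  by rewrite -rgX // -oz expg_order rg1.
have frob g : (g - 1) ^+ (l ^ e) = g ^+ (l ^ e) - 1 :> 'M[F]_2.
  elim: (e) => [|d IH]; first by rewrite !expr1.
  have := pFrobenius_autB_comm (pchar_mat2 lch) (commr1 (g ^+ (l ^ d))).
  by rewrite !pFrobenius_autE expr1n -IH -!exprM -expnSr.
by apply/eqP; apply: (@nilp_sqr0 _ _ (l ^ e)); rewrite frob z1 subrr.
Qed.

(** The image of a Sylow [l]-subgroup of [M] consists of unipotents with the same
fixed line, which the normaliser must preserve. The normaliser is thus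
triangular, its second derived subgroup acts trivially, and the Frattini
argument expresses the perfect group [G] through [M] and that subgroup. *)
Lemma frattini_cover M y : (M <| G)%g -> y \in M ->
  unipotent (rG y) -> rG y != 1 -> G \subset (M * rker rG)%g.
Proof.
move=> nM My uy yn1.
have sMG := normal_sub nM; have Gy := subsetP sMG _ My.
have y2 : (rG y - 1) * (rG y - 1) = 0 by apply/eqP.
have ey : rG y = 1 + (rG y - 1) by rewrite addrC subrK.
pose n := (#[y]%g`_l^')%N.
(* The image of y has order l, but y itself may not be an l-element. *)
pose z := (y ^+ n)%g.
have Mz : z \in M by rewrite groupX.
have Gz : z \in G by rewrite groupX.
have zl : (l.-elt z)%g.
  rewrite /p_elt /z orderXgcd.
  have -> : gcdn #[y]%g n = n by apply/gcdn_idPr; apply: dvdn_part.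
  by rewrite -{1}(partnC l (order_gt0 y)) mulnK ?part_gt0 // part_pnat.
have ez : rG z = 1 + (rG y - 1) *+ n by rewrite rgX // {1}ey unip_exp.
have [A [An0 A2 eA]] : exists A, [/\ A != 0, A * A = 0 & rG z = 1 + A].
  exists ((rG y - 1) *+ n); split=> //; last by rewrite mulrnAl mulrnAr y2 !mul0rn.
  rewrite -scaler_nat scaler_eq0 negb_or subr_eq0 yn1 andbT -(dvdn_pcharf lch).
  apply/negP=> ln; have := part_pnat (negn l) #[y]%g; rewrite -/n.
  move=> /(pnatPpi)/(_ (_ : l \in \pi(n))).
  by rewrite !inE mem_primes l_prime part_gt0 ln eqxx => /(_ isT).
have sub_z : <[z]>%g \subset M by rewrite cycle_subG.
have [P sylP zP] := Sylow_superset sub_z zl.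
have Pz : z \in P by rewrite -cycle_subG.
have lP := pHall_pgroup sylP; have sPM := pHall_sub sylP.
have sPG := subset_trans sPM sMG.
have [h hu eAh] := nilp_normal An0 A2.
set N := ('N_G(P))%G.
have sNG : N \subset G by rewrite subsetIl.
(* Since z * z ^ x lies in P, its image is unipotent and has trace 2, which
   means that z and z ^ x have the same fixed line. *)
have triN x : x \in N -> exists a b d, rG x = h * mat2 a b 0 d * h^-1.
  case/setIP=> Gx Nx; have xu := rgU Gx.
  have Pzx : (z ^ x)%g \in P by rewrite memJ_norm.
  have Gzx := subsetP sPG _ Pzx.
  pose B := (rG x)^-1 * A * rG x.
  have B2 : B * B = 0.
    rewrite /B -{2 4}(invrK (rG x)) conjM ?unitrV // A2 mulr0 mul0r //.
  have eB : rG (z ^ x)%g = 1 + B.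
    by rewrite rgJ // eA mulrDr mulrDl mulr1 mulVr.
  have t0 : \tr (A * B) = 0.
    have uzz : unipotent (rG (z * z ^ x)%g).
      by apply: unip_elt; [rewrite groupM|apply: (mem_p_elt lP); rewrite groupM].
    have := nilp_trace (eqP uzz).
    have -> : rG (z * z ^ x)%g - 1 = B + (A + A * B).
      rewrite rgM // eA eB mulrDl mul1r mulrDr mulr1 -!addrA addrC -!addrA.
      by rewrite addNr addr0.
    by rewrite !mxtraceD (nilp_trace A2) (nilp_trace B2) !add0r.
  have [b eb] := nilp_collinear An0 A2 B2 t0.
  have [g eg] : exists g, rG x = h * g * h^-1.
    by exists (h^-1 * rG x * h); rewrite !mulrA divrr // mul1r mulrK.
  have: mat2 0 1 0 0 * g = b *: (g * mat2 0 1 0 0).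
    apply: (conj_inj hu); rewrite conjZ -!conjM // -eg -eAh scalerAr -eb /B.
    by rewrite !mulrA divrr // mul1r.
  rewrite eg [g]mat2_eta !mat2E.
  move: (g 0 0) (g 0 1) (g 1 0) (g 1 1) => p q r s /mat2_inj[e _ _ _].
  exists p, q, s; suff -> : r = 0 by [].
  by apply: etrans (etrans _ e) _; ring.
(* The linear form w vanishes on the fixed line, and spans its annihilator. *)
pose w := delta_mx 0 1 *m invmx h : 'rV[F]_2.
have w0 : w != 0.
  apply/eqP=> /(congr1 (mulmx^~ h)); rewrite mul0mx mulmxKV // => /matrixP/(_ 0 1).
  by rewrite !mxE /= => /eqP; rewrite oner_eq0.
have wN a b d : w *m (h * mat2 a b 0 d * h^-1) = d *: w.
  rewrite /w -!mulmxE !mulmxA mulmxKV // scalemxAl; congr (_ *m _).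
  apply/matrixP=> i j; rewrite !mxE !big_ord_recl big_ord0 !mxE /= ord1.
  by case: j => [[|[|]]] //= ?; rewrite ?mulr0 ?mulr1 ?mul0r ?mul1r ?add0r ?addr0.
have sN1 : N^`(1)%g \subset rstab rG w.
  rewrite derg1 gen_subG; apply/subsetP=> _ /imset2P[x v Nx Nv ->].
  have Gx := subsetP sNG _ Nx; have Gv := subsetP sNG _ Nv.
  have vxN : (v * x)%g \in N by rewrite groupM.
  have [a [b [d e]]] := triN _ vxN.
  rewrite inE groupR //=; apply/eqP.
  have d0 : d != 0.
    have : rG (v * x)%g \is a GRing.unit by rewrite rgU // groupM.
    by rewrite e unit_detE det_conj // det_mat2 mulr0 subr0 mulf_eq0 negb_or => /andP[].
  apply: (scalerI d0); rewrite scalemxAl -(wN a b d) -e -mulmxA.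
  rewrite -repr_mxM ?groupR ?groupM //.
  rewrite -commgC !repr_mxM // !mulmxA.
  have [a1 [b1 [d1 e1]]] := triN _ Nx; have [a2 [b2 [d2 e2]]] := triN _ Nv.
  have ex : w *m rG x = d1 *: w by rewrite e1 wN.
  have ev : w *m rG v = d2 *: w by rewrite e2 wN.
  by rewrite ex ev -!scalemxAl ex ev !scalerA mulrC.
have sN2 : N^`(2)%g \subset rker rG.
  have uniN t : t \in N^`(1)%g -> exists b, rG t = h * mat2 1 b 0 1 * h^-1.
    move=> N1t; have Nt := subsetP (der_sub 1 N) _ N1t.
    have [a [b [d e]]] := triN _ Nt; exists b.
    have := subsetP sN1 _ N1t; rewrite inE e wN => /andP[Gt].
    rewrite -subr_eq0 -{2}[w]scale1r -scalerBl scaler_eq0 (negPf w0) orbF.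
    rewrite subr_eq0 => /eqP d1.
    have := det_perfect Gt; rewrite e det_conj // det_mat2 mulr0 subr0 d1 mulr1 => a1.
    by rewrite a1.
  rewrite dergSn gen_subG; apply/subsetP=> _ /imset2P[x v N1x N1v ->].
  have Gx := subsetP sNG _ (subsetP (der_sub 1 N) _ N1x).
  have Gv := subsetP sNG _ (subsetP (der_sub 1 N) _ N1v).
  rewrite rker_repr groupR //=; apply/eqP.
  apply: (mulrI (x := rG v * rG x)); first by rewrite -rgM // rgU // groupM.
  rewrite -rg_comm // mulr1.
  have [b ->] := uniN _ N1x; have [c ->] := uniN _ N1v.
  by rewrite !conjM // !mat2E; congr (_ * mat2 _ _ _ _ * _); ring.
have GMN : (G \subset M * N^`(2))%g.
  have nMG := normal_norm nM; have nMN := subset_trans sNG nMG.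
  have perf2 : (G^`(2) = G)%g by rewrite dergSn perfG -derg1 perfG.
  rewrite -quotientSK // -{1}perf2 !quotient_der //.
  by rewrite -{1}(Frattini_arg nM sylP) quotientMidl.
exact: subset_trans GMN (mulgS _ sN2).
Qed.

Lemma normal_dichotomy M h : (M <| G)%g -> h \is a GRing.unit -> contains_SL2 rG h ->
  M \subset rcenter rG \/ G \subset (M * rker rG)%g.
Proof.
move=> nM hu big.
have [/existsP[y /and3P[My uy yn1]]|/existsPn noy] :=
    boolP [exists y, [&& y \in M, unipotent (rG y) & rG y != 1]].
  by right; apply: frattini_cover yn1.
left; apply: unipotent_free_scalar hu big => // y My uy; apply/eqP.
by have := noy y; rewrite My uy /= negbK.
Qed.

End Single.
End Rep.

(** * Comparison of representations up to sign *)

Section EqPm.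
Variable F : fieldType.
Implicit Types A B C D h : 'M[F]_2.

Definition eqpm A B := A = B \/ A = - B.

Lemma eqpm_refl A : eqpm A A. Proof. by left. Qed.
#[local] Hint Resolve eqpm_refl : core.

Lemma eqpm_sym A B : eqpm A B -> eqpm B A.
Proof. by case=> ->; [left|right; rewrite opprK]. Qed.

Lemma eqpm_trans A B C : eqpm A B -> eqpm B C -> eqpm A C.
Proof. by case=> -> [] ->; rewrite ?opprK; [left|right|right|left]. Qed.

Lemma eqpmM A B C D : eqpm A B -> eqpm C D -> eqpm (A * C) (B * D).
Proof.
by case=> -> [] ->; rewrite ?mulrN ?mulNr ?opprK; [left|right|right|left].
Qed.

Lemma eqpm_exp A B n : eqpm A B -> eqpm (A ^+ n) (B ^+ n).
Proof.
move=> AB; elim: n => [|n IH]; first by left.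
by rewrite !exprS; apply: eqpmM.
Qed.

Lemma eqpm_conj h A B : h \is a GRing.unit ->
  eqpm (h * A * h^-1) (h * B * h^-1) <-> eqpm A B.
Proof.
move=> hu; split=> -[].
- by move/(conj_inj hu); left.
- by rewrite -conjN => /(conj_inj hu); right.
- by move=> ->; left.
- by move=> ->; right; rewrite conjN.
Qed.

End EqPm.

#[local] Hint Resolve eqpm_refl : core.

Section Compare.
Variables (l : nat) (F : fieldType).
Hypotheses (l_prime : prime l) (l_ge5 : (5 <= l)%N) (lch : l \in [pchar F]).
Variables (gT : finGroupType) (G : {group gT}).
Hypothesis perfG : (G^`(1) = G)%g.
Implicit Types (rG : mx_representation F G 2) (M : {group gT}).

Let F2 : (2%:R : F) != 0.
Proof. exact: (natr_pchar_neq0 l_ge5 lch). Qed.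

Lemma elU_pm1 : ~ eqpm (elU F) 1.
Proof.
by rewrite mat2_1 => -[|]; rewrite ?mat2N => /mat2_inj[_ /eqP]; rewrite ?oppr0 oner_eq0.
Qed.

Lemma elU_pm_elL : ~ eqpm (elU F) (elL F).
Proof.
by move=> -[|]; rewrite ?mat2N => /mat2_inj[_ /eqP]; rewrite ?oppr0 oner_eq0.
Qed.

Lemma elU_elL_braid : elU F * elL F * elU F = elL F * elU F * elL F.
Proof. by rewrite !mat2M; congr mat2; ring. Qed.

Lemma rcenter_eqpm rG x : x \in G -> (x \in rcenter rG) <-> eqpm (rG x) 1.
Proof.
move=> Gx; rewrite rcenter_perfect // Gx /=.
by split=> [/orP[]/eqP->|[]->]; [left|right|rewrite eqxx|rewrite eqxx orbT].
Qed.

Lemma eqpm_rcenter rG x y : x \in G -> y \in G ->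
  eqpm (rG x) (rG y) <-> (x * y^-1)%g \in rcenter rG.
Proof.
move=> Gx Gy; have yu := rgU rG Gy.
rewrite rcenter_eqpm ?groupM ?groupV // rgM ?groupV // rgV //.
split=> [xy|xy1].
  by rewrite -(divrr yu); apply: eqpmM.
by rewrite -(mulrVK yu (rG x)) -[X in eqpm _ X]mul1r; apply: eqpmM.
Qed.

Lemma SL2_not_scalar rG h : h \is a GRing.unit -> contains_SL2 l rG h ->
  ~ G \subset rcenter rG.
Proof.
move=> hu big; have [|x Gx ex] := big (elU _); first by rewrite det_mat2; ring.
move/subsetP/(_ _ Gx)/(rcenter_eqpm rG Gx).
rewrite ex Fl_mx_elU // -[X in eqpm _ X](conj1 hu) eqpm_conj //.
exact: elU_pm1.
Qed.

(** The dichotomy applies to each kernel in the other representation. If one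
kernel is strictly contained in the other, the larger one covers the image of
the representation with the smaller kernel, hence is [G]. *)
Lemma rcenter_compare rG1 rG2 h1 h2 :
    h1 \is a GRing.unit -> contains_SL2 l rG1 h1 ->
    h2 \is a GRing.unit -> contains_SL2 l rG2 h2 ->
  rcenter rG1 = rcenter rG2 \/ G \subset (rcenter rG2 * rcenter rG1)%g.
Proof.
move=> hu1 big1 hu2 big2.
have sub rG : rker rG \subset rcenter rG.
  by apply/subsetP=> x /rkerP[Gx rx]; apply/rcenter_eqpm => //; left.
have n1 : (rcenter_group rG1 <| G)%g := rcenter_normal rG1.
have n2 : (rcenter_group rG2 <| G)%g := rcenter_normal rG2.
have [s12|c] := normal_dichotomy l_prime l_ge5 lch perfG n1 hu2 big2; last first.
  right; apply: subset_trans c _ => /=.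
  have nK : rcenter rG1 \subset 'N(rker rG2)%g.
    exact: subset_trans (normal_sub n1) (normal_norm (rker_normal rG2)).
  by rewrite (normC nK) mulSg.
have [s21|c] := normal_dichotomy l_prime l_ge5 lch perfG n2 hu1 big1.
  by left; apply/eqP; rewrite eqEsubset s12 s21.
case: (SL2_not_scalar hu2 big2); apply: subset_trans c _.
have s1 : rker rG1 \subset rcenter_group rG2 := subset_trans (sub rG1) s12.
by rewrite mulGSid.
Qed.

(** Modulo [K], both [A] and [B] become the whole group, and the commutators of
elements of [A] with elements of [B] lie in both. *)
Lemma perfect_cap (A B K : {group gT}) :
    (A <| G)%g -> (B <| G)%g -> (K <| G)%g ->
    G \subset (K * A)%g -> G \subset (K * B)%g -> G \subset (K * (A :&: B))%g.
Proof.
move=> nA nB nK; have nKG := normal_norm nK.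
have [sA sB] := (normal_sub nA, normal_sub nB).
rewrite -!quotientSK // => GA GB; apply: subset_trans (_ : _ \subset [~: A, B] / K)%g _.
  rewrite -{1}perfG derg1 !quotientR ?commgSS //; exact: subset_trans nKG.
apply: quotientS; rewrite subsetI commg_subl commg_subr.
by rewrite (subset_trans sB (normal_norm nA)) (subset_trans sA (normal_norm nB)).
Qed.

(** Unlike [contains_SL2], this property is carried from a representation to
another with the same kernel to scalars, for a suitable conjugating matrix. *)
Definition contains_PSL2 rG (h : 'M[F]_2) :=
  forall A : 'M['F_l]_2, \det A = 1 ->
    exists2 x, x \in G & eqpm (rG x) (h * Fl_mx F A * h^-1).

(** As [l] is odd, the sign of [g] can be changed so that its [l]-th power is 1. *)
Lemma unip_of_pow_pm (g : 'M[F]_2) : eqpm (g ^+ l) 1 ->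
  exists2 A, A * A = 0 & eqpm g (1 + A).
Proof.
case=> e.
  exists (g - 1); first exact: unip_of_pow_char lch _ e.
  by left; rewrite addrC subrK.
have lodd : odd l by case: (even_prime l_prime) => // l2; move: l_ge5; rewrite l2.
exists (- g - 1); last by right; rewrite addrC subrK opprK.
by apply: (unip_of_pow_char lch); rewrite exprNn e -signr_odd lodd expr1 mulrNN mulr1.
Qed.

(** Relations modulo scalars are the same in both representations. The point is
that [h'] depends on [h] only: it is obtained from the images under [rG2] of
elements lifting the standard generators, and works for all [A] at once. *)
Lemma transfer_conj rG1 rG2 h : rcenter rG1 = rcenter rG2 ->
    h \is a GRing.unit -> contains_PSL2 rG1 h ->
  exists2 h', h' \is a GRing.unit &
    forall x (A : 'M['F_l]_2), x \in G -> \det A = 1 ->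
      eqpm (rG1 x) (h * Fl_mx F A * h^-1) ->
      eqpm (rG2 x) (h' * Fl_mx F A * h'^-1).
Proof.
move=> eK hu big.
have tr x y : x \in G -> y \in G -> eqpm (rG1 x) (rG1 y) <-> eqpm (rG2 x) (rG2 y).
  by move=> Gx Gy; rewrite !eqpm_rcenter // eK.
have tr1 x : x \in G -> eqpm (rG1 x) 1 <-> eqpm (rG2 x) 1.
  by move=> Gx; have := tr _ _ Gx (group1 G); rewrite !rg1.
have [|u Gu] := big (elU _); first by rewrite det_mat2; ring.
rewrite Fl_mx_elU // => eu.
have [|v Gv] := big (elL _); first by rewrite det_mat2; ring.
rewrite Fl_mx_elL // => ev.
have conjX g n : (h * g * h^-1) ^+ n = h * g ^+ n * h^-1.
  elim: n => [|n IH]; first by rewrite !expr0 conj1.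
  by rewrite !exprS IH conjM.
have l0 : (l%:R : F) = 0 by apply: (pcharf0 lch).
have [A A2 eA] : exists2 A, A * A = 0 & eqpm (rG2 u) (1 + A).
  apply: unip_of_pow_pm; rewrite -rgX //; apply/tr1; first exact: groupX.
  rewrite rgX // -(conj1 hu).
  have -> : 1 = elU F ^+ l by rewrite elU_exp l0 mat2_1.
  by rewrite -conjX; apply: eqpm_exp.
have [B B2 eB] : exists2 B, B * B = 0 & eqpm (rG2 v) (1 + B).
  apply: unip_of_pow_pm; rewrite -rgX //; apply/tr1; first exact: groupX.
  rewrite rgX // -(conj1 hu).
  have -> : 1 = elL F ^+ l by rewrite elL_exp l0 oppr0 mat2_1.
  by rewrite -conjX; apply: eqpm_exp.
have A0 : A != 0.
  apply/eqP=> A0; move: eA; rewrite A0 addr0 => /(tr1 _ Gu) e1.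
  have := eqpm_trans (eqpm_sym eu) e1; rewrite -[X in eqpm _ X](conj1 hu) eqpm_conj //.
  exact: elU_pm1.
have AB : A != B.
  apply/eqP=> AB; rewrite -AB in eB.
  have /(tr _ _ Gu Gv) e1 := eqpm_trans eA (eqpm_sym eB).
  have := eqpm_trans (eqpm_sym eu) (eqpm_trans e1 ev); rewrite eqpm_conj //.
  exact: elU_pm_elL.
have br : eqpm ((1 + A) * (1 + B) * (1 + A)) ((1 + B) * (1 + A) * (1 + B)).
  have e1 : eqpm (rG1 (u * v * u)%g) (rG1 (v * u * v)%g).
    rewrite !rgM ?groupM //.
    apply: (eqpm_trans (eqpmM (eqpmM eu ev) eu)).
    apply: eqpm_sym; apply: (eqpm_trans (eqpmM (eqpmM ev eu) ev)).
    by left; rewrite !conjM // elU_elL_braid.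
  have Guvu : (u * v * u)%g \in G by rewrite !groupM.
  have Gvuv : (v * u * v)%g \in G by rewrite !groupM.
  move/(tr _ _ Guvu Gvuv): e1; rewrite !rgM ?groupM // => e1.
  apply: (eqpm_trans (eqpm_sym (eqpmM (eqpmM eA eB) eA))).
  exact: (eqpm_trans e1 (eqpmM (eqpmM eB eA) eB)).
have [h' hu' [eA' eB']] := braid_standard F2 A0 AB A2 B2 br.
exists h' => // x C Gx C1 ex.
suff [y Gy [ey1 ey2]] : exists2 y, y \in G &
    eqpm (rG1 y) (h * Fl_mx F C * h^-1) /\ eqpm (rG2 y) (h' * Fl_mx F C * h'^-1).
  apply: eqpm_trans ey2; apply/tr => //; exact: (eqpm_trans ex (eqpm_sym ey1)).
move: C C1 {x Gx ex}.
apply: (SL2_gen (Fl_natr l_prime)).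
- move=> g1 g2 [y1 Gy1 [e1 f1]] [y2 Gy2 [e2 f2]].
  exists (y1 * y2)%g; first by rewrite groupM.
  by rewrite !rgM // Fl_mxM // -!conjM //; split; apply: eqpmM.
- by exists u => //; rewrite Fl_mx_elU // -eA'.
- by exists v => //; rewrite Fl_mx_elL // -eB'.
Qed.

(** The same matrix [h] must conjugate the image of [x] to [gamma] and the image
of the group to one containing SL_2(F_l), for [transfer_conj] to apply to it. *)
Definition realizes rG (gamma : 'M['F_l]_2) x := exists2 h, h \is a GRing.unit &
  contains_PSL2 rG h /\ eqpm (rG x) (h * Fl_mx F gamma * h^-1).

Variables (I : eqType) (r : I -> mx_representation F G 2).
Hypothesis big : forall i, exists2 h, h \is a GRing.unit & contains_SL2 l (r i) h.

(** Goursat's lemma for the perfect group [G]: a kernel distinct from finitely many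
others is complemented by their intersection. *)
Lemma common_scalars (J : seq I) i :
    (forall j, j \in J -> rcenter (r j) <> rcenter (r i)) ->
  exists M, [/\ (M <| G)%g, forall j, j \in J -> M \subset rcenter (r j)
    & G \subset (rcenter (r i) * M)%g].
Proof.
elim: J => [|j J IH] neK.
  exists G; split=> //.
  by rewrite (mulSGid (normal_sub (rcenter_normal (r i)) : rcenter_group (r i) \subset G)).
have [|M [nM sM GM]] := IH; first by move=> j' Jj'; apply: neK; rewrite inE Jj' orbT.
have nK : (rcenter_group (r j) <| G)%g := rcenter_normal (r j).
exists (M :&: rcenter_group (r j))%G; split.
- exact: normalI.
- move=> j'; rewrite inE => /predU1P[->|/sM sMj']; first exact: subsetIr.
  exact: subset_trans (subsetIl _ _) sMj'.
- apply: perfect_cap => //; first exact: (rcenter_normal (r i)).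
  have [hi hui bi] := big i; have [hj huj bj] := big j.
  by have [/neK|//] := rcenter_compare huj bj hui bi; rewrite mem_head => /(_ isT).
Qed.

(** Induction on [J]. A new index with a kernel already met is taken care of by
[transfer_conj]; otherwise [x] can be multiplied by an element which is scalar
under the previous representations and arbitrary under the new one. *)
Lemma perfect_common (gamma : 'M['F_l]_2) (J : seq I) : \det gamma = 1 ->
  exists2 x, x \in G & forall i, i \in J -> realizes (r i) gamma x.
Proof.
move=> g1; elim: J => [|i J [x Gx gx]]; first by exists 1%g.
have [/hasP[j Jj /eqP eK]|/hasPn neK] :=
    boolP (has (fun j => rcenter (r j) == rcenter (r i)) J).
  exists x => // i'; rewrite inE => /predU1P[->|]; last exact: gx.
  have [h hu [bh ex]] := gx _ Jj.
  have [h' hu' tr] := transfer_conj eK hu bh.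
  exists h' => //; split; last exact: tr.
  by move=> A A1; have [y Gy ey] := bh _ A1; exists y => //; apply: tr.
have [|M [nM sM GM]] := @common_scalars J i; first by move=> j /neK/eqP.
have [h hu bh] := big i; have [y Gy ey] := bh _ g1.
have : (x^-1 * y)%g \in G by rewrite groupM ?groupV.
move/(subsetP GM)/mulsgP=> [c m Kc Mm e].
have Gm := subsetP (normal_sub nM) _ Mm.
have Gc := subsetP (normal_sub (rcenter_normal (r i))) _ Kc.
exists (x * m)%g; first by rewrite groupM.
move=> i'; rewrite inE => /predU1P[->|Ji'].
  exists h => //; split; first by move=> A /bh[z Gz ez]; exists z => //; left.
  have {}e : y = (x * c * m)%g by rewrite -mulgA -e mulKVg.
  rewrite -ey e !rgM ?groupM //; apply: eqpmM; last exact: eqpm_refl.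
  rewrite -[X in eqpm X _]mulr1; apply: eqpmM; first exact: eqpm_refl.
  by apply: eqpm_sym; apply/rcenter_eqpm.
have [h' hu' [bh' ex]] := gx _ Ji'.
exists h' => //; split=> //; rewrite rgM // -[X in eqpm _ X]mulr1.
by apply: eqpmM => //; apply/rcenter_eqpm => //; apply: (subsetP (sM _ Ji')).
Qed.
End Compare.

(** * A common element for finitely many representations *)

Section Core.
Variables (l : nat) (F : fieldType).
Hypotheses (l_prime : prime l) (l_ge5 : (5 <= l)%N) (lch : l \in [pchar F]).

(** Elementary matrices are commutators, taking [t = 2]: here 3 must be invertible. *)
Lemma contains_SL2_der (gT : finGroupType) (G : {group gT})
    (rG : mx_representation F G 2) h : h \is a GRing.unit ->
  contains_SL2 l rG h -> contains_SL2 l (subg_repr rG (der_sub 1 G)) h.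
Proof.
move=> hu big.
have nz n : (0 < n < 5)%N -> (n%:R : 'F_l) != 0.
  by apply: natr_pchar_neq0; first exact: l_ge5; apply: pchar_Fp.
have t0 : (2%:R : 'F_l) != 0 by apply: nz.
have t1 : (2%:R : 'F_l) ^+ 2 != 1.
  by rewrite -subr_eq0 (_ : _ - _ = 3%:R) ?nz //; ring.
have comm (E : 'M['F_l]_2) :
    (exists g g', [/\ \det g = 1, \det g' = 1 & g * g' = E * (g' * g)]) ->
    exists2 x, x \in G^`(1)%g & rG x = h * Fl_mx F E * h^-1.
  move=> [g [g' [d d' e]]].
  have [x Gx ex] := big _ d; have [y Gy ey] := big _ d'.
  exists [~ x^-1, y^-1]%g.
    by rewrite derg1 mem_commg ?groupV.
  have -> : [~ x^-1, y^-1]%g = (x * y * (y * x)^-1)%g.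
    by rewrite commgEl conjgE !invgK invMg !mulgA.
  have [Gxy Gyx] : (x * y)%g \in G /\ (y * x)%g \in G by rewrite !groupM.
  apply: (mulIr (rgU rG Gyx)); rewrite -rgM ?groupMl ?groupV //.
  by rewrite mulgKV !rgM // ex ey !conjM // -!Fl_mxM // e.
apply: (SL2_gen (Fl_natr l_prime)).
- move=> g1 g2 [x1 Gx1 e1] [x2 Gx2 e2].
  exists (x1 * x2)%g; first by rewrite groupM.
  by rewrite rgM // e1 e2 conjM // Fl_mxM.
- exact: comm (elU_comm t0 t1).
- exact: comm (elL_comm t0 t1).
Qed.

(** Induction on the order of [G], going down the derived series until a perfect
group is reached. *)
Lemma common_element (gT : finGroupType) (G : {group gT}) (I : finType)
    (r : I -> mx_representation F G 2) (gamma : 'M['F_l]_2) :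
    (forall i, exists2 h, h \is a GRing.unit & contains_SL2 l (r i) h) ->
    \det gamma = 1 ->
  exists2 x, x \in G^`(1)%g & forall i, exists2 h, h \is a GRing.unit &
    eqpm (r i x) (h * Fl_mx F gamma * h^-1).
Proof.
move=> big g1; have [n] := ubnP #|G|; elim: n G r big => // n IH G r big Gn.
have [perfG|nperf] := eqVneq (G^`(1)%g : {set gT}) G.
  have [x Gx gx] := perfect_common l_prime l_ge5 lch perfG big (enum I) g1.
  exists x; first by rewrite perfG.
  by move=> i; have [|h hu [_ ex]] := gx i; rewrite ?mem_enum //; exists h.
have ltG : (#|G^`(1)%g| < n)%N.
  apply: leq_trans (_ : #|G| <= n)%N; last by rewrite -ltnS.
  by apply: proper_card; rewrite properEneq nperf der_sub.
have [|x Gx gx] := IH _ (fun i => subg_repr (r i) (der_sub 1 G)) _ ltG.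
  by move=> i; have [h hu bi] := big i; exists h => //; apply: contains_SL2_der.
by exists x => //; apply: subsetP Gx; apply: der_sub.
Qed.
End Core.

(** * Finite quotients of the Galois group *)

From mathcomp Require Import complex.
From mathcomp Require Import all_classical all_reals all_analysis.

(** Being a morphism is a proposition, so proof irrelevance applies. *)
Lemma GQ_ext (s t : GQ) : s =1 t -> s = t.
Proof.
case: s t => [s [[s1] [s2]]] [t [[t1] [t2]]] /= st.
have e : s = t by apply/funext.
rewrite -{}e {st} in t1 t2 *.
by rewrite (Prop_irrelevance s1 t1) (Prop_irrelevance s2 t2).
Qed.

Definition GQV (s : GQ) : GQ := algC_invaut s.

Lemma GQMVK (s t : GQ) : GQM s (GQM (GQV s) t) = t.
Proof. by apply: GQ_ext => x /=; rewrite algC_invautK. Qed.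

(** Add the roots of the minimal polynomials of the elements of [X]. *)
Lemma stable_superset (X : seq algC) : exists Y : seq algC,
  {subset X <= Y} /\ forall (s : GQ) y, y \in Y -> s y \in Y.
Proof.
elim: X => [|x X [Y [XY sY]]]; first by exists [::].
have [p [_ pm] pP] := minCpolyP x.
pose q : {poly algC} := map_poly ratr p.
have q0 : q != 0 by rewrite map_poly_eq0 monic_neq0.
have [r er] := closed_field_poly_normal q.
have rP y : (y \in r) = root q y.
  by rewrite er rootZ ?lead_coef_eq0 // root_prod_XsubC.
exists (r ++ Y); split=> [y|s y].
  rewrite inE mem_cat => /predU1P[->|/XY->]; last by rewrite orbT.
  by rewrite rP pP dvdpp.
rewrite !mem_cat => /orP[|/sY->]; last by rewrite orbT.
rewrite !rP /root => /eqP qy; apply/orP; left.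
have <- : map_poly s q = q.
  by rewrite /q -map_poly_comp; apply: eq_map_poly => a /=; rewrite fmorph_rat.
by rewrite horner_map qy rmorph0.
Qed.

(** The quotient is realised by the permutations of a finite stable set containing
[X]; inverses are taken since permutations compose from left to right. *)
Lemma finite_quotient (X : seq algC) :
  exists (gT : finGroupType) (G : {group gT}) (theta : GQ -> gT),
    [/\ forall s, theta s \in G, forall x, x \in G -> exists s, theta s = x,
        forall s t, theta (GQM s t) = (theta s * theta t)%g
      & forall s t, theta s = theta t -> {in X, s =1 t}].
Proof.
have [Y [XY sY]] := stable_superset X.
pose T := seq_sub Y.
pose act (s : GQ) (y : T) : T := SeqSub (sY s _ (valP y)).
have act_inj s : injective (act s).
  by move=> y z /(congr1 val)/= /(fmorph_inj s)/val_inj.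
pose theta (s : GQ) := ((perm (act_inj s))^-1)%g.
have thetaM s t : theta (GQM s t) = (theta s * theta t)%g.
  rewrite /theta -invMg; congr (_^-1)%g; apply/permP=> y.
  by rewrite permM !permE; apply: val_inj.
have theta1 : theta GQ1 = 1%g.
  rewrite /theta -[RHS]invg1; congr (_^-1)%g; apply/permP=> y.
  by rewrite permE perm1; apply: val_inj.
pose D := [set x | `[< exists s, theta s = x >]]%SET.
have gD : group_set D.
  apply/group_setP; split; first by rewrite finset.inE; apply/asboolP; exists GQ1.
  move=> x y; rewrite !finset.inE => /asboolP[s <-] /asboolP[t <-].
  by apply/asboolP; exists (GQM s t).
exists {perm T}, (Group gD), theta; split=> //.
- by move=> s; rewrite finset.inE; apply/asboolP; exists s.
- by move=> x; rewrite finset.inE => /asboolP.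
move=> s t /invg_inj/permP st x /XY Yx.
by have := st (SeqSub Yx); rewrite !permE => /(congr1 val).
Qed.

(** Automorphisms raise roots of unity to powers, and such operations commute. *)
Lemma der_fixes_root (l : nat) (zeta : algC) (X : seq algC) (gT : finGroupType)
    (G : {group gT}) (theta : GQ -> gT) :
    l.-primitive_root zeta -> zeta \in X ->
    (forall s, theta s \in G) -> (forall x, x \in G -> exists s, theta s = x) ->
    (forall s t, theta (GQM s t) = (theta s * theta t)%g) ->
    (forall s t, theta s = theta t -> {in X, s =1 t}) ->
  forall s, theta s \in G^`(1)%g -> s zeta = zeta.
Proof.
move=> zp Xz tG tsurj tM tX.
have tz s t : theta s = theta t -> s zeta = t zeta by move/tX; apply.
have pw (s : GQ) : exists k, s zeta = zeta ^+ k.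
  have : s zeta ^+ l = 1 by rewrite -rmorphXn (prim_expr_order zp) rmorph1.
  by case/(prim_rootP zp) => k; exists k.
have comm (s t : GQ) : s (t zeta) = t (s zeta).
  have [a ea] := pw s; have [b eb] := pw t.
  by rewrite ea eb !rmorphXn ea eb -!exprM mulnC.
have t1 : theta GQ1 = 1%g.
  by apply: (mulgI (theta GQ1)); rewrite mulg1 -tM; congr theta; apply: GQ_ext.
pose D := [set x in G | `[< forall s, theta s = x -> s zeta = zeta >]]%SET.
have gD : group_set D.
  apply/group_setP; split.
    by rewrite finset.inE group1; apply/asboolP => s; rewrite -t1 => /tz.
  move=> x y; rewrite !finset.inE => /andP[Gx /asboolP fx] /andP[Gy /asboolP fy].
  rewrite groupM //; apply/asboolP => u.
  have [s es] := tsurj _ Gx; have [t et] := tsurj _ Gy.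
  by rewrite -es -et -tM => /tz -> /=; rewrite (fy _ et) (fx _ es).
have sD : (G^`(1)%g \subset Group gD)%SET.
  rewrite derg1 gen_subG; apply/fintype.subsetP=> _ /imset2P[x y Gx Gy ->].
  rewrite finset.inE groupR //=; apply/asboolP => u eu.
  have [s es] := tsurj _ Gx; have [t et] := tsurj _ Gy.
  have : theta (GQM s t) = theta (GQM (GQM t s) u).
    by rewrite !tM es et eu -commgC.
  by move/tz => /=; rewrite comm => /fmorph_inj/fmorph_inj/esym.
move=> s /(fintype.subsetP sD); rewrite finset.inE => /andP[_ /asboolP]; exact.
Qed.

Lemma descend_rep (F : fieldType) (X : seq algC) (gT : finGroupType)
    (G : {group gT}) (theta : GQ -> gT) (r : GQ -> 'M[F]_2) :
    (forall s, theta s \in G) -> (forall x, x \in G -> exists s, theta s = x) ->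
    (forall s t, theta (GQM s t) = (theta s * theta t)%g) ->
    (forall s t, theta s = theta t -> {in X, s =1 t}) ->
    is_rep r -> (forall s t : GQ, {in X, s =1 t} -> r s = r t) ->
  exists rG : mx_representation F G 2, forall s, rG (theta s) = r s.
Proof.
move=> tG tsurj tM tX [r1 rM] rX.
have exlift x : exists s, x \in G -> theta s = x.
  have [Gx|_] := boolP (x \in G); last by exists GQ1.
  by have [s es] := tsurj _ Gx; exists s.
have [lift liftP] := choice exlift.
have rE s t : theta s = theta t -> r s = r t by move/tX/rX.
have t1 : theta GQ1 = 1%g.
  by apply: (mulgI (theta GQ1)); rewrite mulg1 -tM; congr theta; apply: GQ_ext.
have rP : mx_repr G (r \o lift).
  split=> [|x y Gx Gy] /=.
    by rewrite -r1; apply: rE; rewrite liftP.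
  by rewrite -rM; apply: rE; rewrite tM !liftP ?groupM.
by exists (MxRepresentation rP) => s /=; apply: rE; rewrite liftP.
Qed.

(** * Residual representations *)

Section RepConstructions.
Variable K : fieldType.
Implicit Types r : GQ -> 'M[K]_2.

Lemma conj_is_rep r r' : is_rep r -> conj_rep r r' -> is_rep r'.
Proof.
move=> [r1 rM] [h hu e]; split=> [|s t].
  by rewrite e r1 mulmx1 mulmxV.
rewrite !e rM; have hu' : h \is a GRing.unit by [].
by have /esym := conjM (r s) (r t) hu'.
Qed.

Lemma diag_is_rep r : is_rep r -> (forall s, r s 1 0 = 0) ->
  is_rep (fun s => \matrix_(i, j) (r s i j *+ (i == j))).
Proof.
move=> [r1 rM] tri.
have E s : \matrix_(i, j) (r s i j *+ (i == j)) = mat2 (r s 0 0) 0 0 (r s 1 1).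
  by rewrite [LHS]mat2_eta !mxE.
split=> [|s t]; first by rewrite E r1 !mxE /= -mat2_1.
rewrite !E rM mulmxE [RHS](mat2M (r s 0 0)).
rewrite {1 2}[r s]mat2_eta {1 2}[r t]mat2_eta mat2M !tri !mxE /=.
by congr mat2; ring.
Qed.

Lemma semisimplification_rep r r' : is_rep r -> semisimplification r r' ->
  is_rep r' /\ (forall s t, r s = r t -> r' s = r' t).
Proof.
move=> rr [[_ c]|[r0 [c0 tri c]]].
  by split; [exact: conj_is_rep c|move=> s t e; case: c => h _ E; rewrite !E e].
have rr0 := conj_is_rep rr c0.
split; first exact: conj_is_rep (diag_is_rep rr0 tri) c.
move=> s t e; case: c => h _ E; case: c0 => h0 _ E0; rewrite !E.
by congr (_ *m _ *m _); apply/matrixP=> i j; rewrite !mxE !E0 e.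
Qed.

End RepConstructions.

Section Residue.
Variables (R : realType) (l : nat) (L : closedFieldType) (abs : L -> R).
Variables (F : closedFieldType) (red : L -> F).
Hypotheses (l_prime : prime l) (L_Qlbar : is_Qlbar l abs).
Hypothesis F_residue : is_residue abs red.

Let absM := absM L_Qlbar.

Lemma abs0 : abs 0 = 0.
Proof. exact/(abs_eq0 L_Qlbar). Qed.

Lemma abs1 : abs 1 = 1.
Proof.
have n0 : abs 1 != 0 by apply/eqP=> /(abs_eq0 L_Qlbar)/eqP; rewrite oner_eq0.
by apply: (mulfI n0); rewrite -absM !mulr1.
Qed.

Lemma absD_le1 x y : abs x <= 1 -> abs y <= 1 -> abs (x + y) <= 1.
Proof. by move=> x1 y1; apply: le_trans (abs_ultra L_Qlbar x y) _; rewrite ge_max x1. Qed.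

Lemma absD_lt1 x y : abs x < 1 -> abs y < 1 -> abs (x + y) < 1.
Proof.
by move=> x1 y1; apply: le_lt_trans (abs_ultra L_Qlbar x y) _; rewrite gt_max x1.
Qed.

Lemma absM_le1 x y : abs x <= 1 -> abs y <= 1 -> abs (x * y) <= 1.
Proof. by move=> x1 y1; rewrite absM mulr_ile1 // (abs_ge0 L_Qlbar). Qed.

Lemma abs_nat n : abs n%:R <= 1.
Proof.
elim: n => [|n IH]; first by rewrite abs0 ler01.
by rewrite -natr1; apply: absD_le1; rewrite ?abs1.
Qed.

Lemma red0 : red 0 = 0.
Proof. by apply/(red_eq0 F_residue); rewrite abs0 ?ler01 ?ltr01. Qed.

Lemma red_nat n : red n%:R = n%:R.
Proof.
elim: n => [|n IH]; first exact: red0.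
by rewrite -!natr1 (redD F_residue) ?abs_nat ?abs1 // IH (red1 F_residue).
Qed.

Lemma residue_char : l \in [pchar F].
Proof.
apply/andP; split=> //; rewrite -red_nat; apply/eqP/(red_eq0 F_residue); first exact: abs_nat.
by rewrite (abs_l L_Qlbar) invf_lt1 ?ltr0n ?ltr1n ?prime_gt0 ?prime_gt1.
Qed.

Lemma red_near1 x : abs (x - 1) < 1 -> red x = 1.
Proof.
move=> x1; have e : red (x - 1) = 0 by apply/(red_eq0 F_residue); rewrite ?ltW.
have := redD F_residue (ltW x1) (_ : abs 1 <= 1).
by rewrite abs1 lexx subrK e (red1 F_residue) add0r; apply.
Qed.

Definition integral_mx (A : 'M[L]_2) := forall i j, abs (A i j) <= 1.

Lemma red_mxM A B : integral_mx A -> integral_mx B ->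
  map_mx red (A *m B) = map_mx red A *m map_mx red B.
Proof.
move=> iA iB; rewrite [LHS]mat2_eta [map_mx red A]mat2_eta [map_mx red B]mat2_eta.
rewrite [RHS]mat2M !mxE !big_ord_recl !big_ord0 !addr0.
have E : lift ord0 ord0 = 1 :> 'I_2 by apply: val_inj.
by rewrite !E !(redD F_residue) ?absM_le1 // !(redM F_residue).
Qed.

Lemma red_is_rep (r : GQ -> 'M[L]_2) : is_rep r -> (forall s, integral_mx (r s)) ->
  is_rep (fun s => map_mx red (r s)).
Proof.
move=> [r1 rM] ir; split=> [|s t]; last by rewrite rM red_mxM.
apply/matrixP=> i j; rewrite r1 !mxE.
by case: (i == j); rewrite ?mulr1n ?mulr0n ?(red1 F_residue) ?red0.
Qed.

(** The bound makes continuity of a representation at 1 independent of the choice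
of a basis. *)
Lemma conj_small (h k : 'M[L]_2) : exists2 e : R, 0 < e &
  forall D : 'M[L]_2, (forall i j, abs (D i j) < e) ->
    forall i j, abs ((h *m D *m k) i j) < 1.
Proof.
pose nrm (A : 'M[L]_2) : R := 1 + \sum_i \sum_j abs (A i j).
have aR x : 0 <= abs x := abs_ge0 L_Qlbar x.
have nrm_gt0 A : 0 < nrm A.
  by rewrite ltr_pwDl // sumr_ge0 // => i _; rewrite sumr_ge0.
have le_nrm (A : 'M[L]_2) i j : abs (A i j) <= nrm A.
  rewrite /nrm (bigD1 i) //= (bigD1 j) //=.
  have S0 p P : 0 <= \sum_(q | P q) abs (A p q) by apply: sumr_ge0.
  apply: ler_wpDl => //; apply: ler_wpDr; last exact: ler_wpDr.
  by apply: sumr_ge0 => p _; apply: S0.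
exists ((nrm h * nrm k)^-1); first by rewrite invr_gt0 mulr_gt0.
move=> D Dsmall i j.
have sumlt (f : 'I_2 -> L) : (forall p, abs (f p) < 1) -> abs (\sum_p f p) < 1.
  move=> f1; apply: (big_ind (fun x => abs x < 1)) => //; first by rewrite abs0.
  exact: absD_lt1.
rewrite mxE; apply: (sumlt) => q; rewrite mxE mulr_suml; apply: (sumlt) => p.
rewrite !absM mulrAC.
have hk : 0 < nrm h * nrm k by rewrite mulr_gt0.
apply: (@le_lt_trans _ _ (nrm h * nrm k * abs (D p q))).
  by rewrite ler_wpM2r // ler_pM.
by rewrite -(divff (lt0r_neq0 hk)) ltr_pM2l.
Qed.

(** Near 1 the integral model of [r] is congruent to 1, so that its reduction is
trivial on an open subgroup; being multiplicative, the reduction depends only on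
the action on a finite set. *)
Lemma reduction_finite (r : GQ -> 'M[L]_2) (rbar : GQ -> 'M[F]_2) :
    is_rep r -> continuous_rep abs r -> ss_reduction abs red r rbar ->
  is_rep rbar /\ exists X : seq algC, forall s t : GQ, {in X, s =1 t} -> rbar s = rbar t.
Proof.
move=> rr cr [r0 [c0 ir0 ss]]; have rr0 := conj_is_rep rr c0.
have rred := red_is_rep rr0 ir0.
have [rbr bar_eq] := semisimplification_rep rred ss.
split=> //; have [h hu e] := c0.
have [eps eps0 small] := conj_small h (invmx h).
have [X XP] := cr GQ1 _ eps0; exists X => s t st; apply: bar_eq.
rewrite -(GQMVK s t); have [_ ->] := rred.
suff -> : map_mx red (r0 (GQM (GQV s) t)) = 1%:M by rewrite mulmx1.
have fX : {in X, GQM (GQV s) t =1 GQ1}.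
  by move=> x Xx /=; rewrite -st //; apply: algC_autK.
have near1 : forall i j, abs ((r0 (GQM (GQV s) t) - 1%:M) i j) < 1.
  have [r01 _] := rr0; rewrite -r01 !e -mulmxBl -mulmxBr; apply: small => i j.
  by have := XP _ fX i j; rewrite !mxE.
apply/matrixP=> i j; have := near1 i j; rewrite !mxE.
case: (i == j); first exact: red_near1.
by rewrite mulr0n subr0 => a1; apply/(red_eq0 F_residue) => //; apply: ltW.
Qed.

End Residue.

(** * The theorem *)

Theorem proposition3p5
  (R : realType) (l k N s : nat) (psi : int -> algC)
  (iC : {rmorphism algC -> R[i]})
  (L : closedFieldType) (abs : L -> R) (iota : {rmorphism algC -> L})
  (F : closedFieldType) (red : L -> F)
  (zeta : algC)
  (f : 'I_s -> R[i] -> R[i]) (a : 'I_s -> nat -> algC)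
  (rho : 'I_s -> GQ -> 'M[L]_2) (rhobar : 'I_s -> GQ -> 'M[F]_2)
  (l_prime : prime l) (l_ge5 : (5 <= l)%N)
  (k_gt0 : (0 < k)%N) (k_even : ~~ odd k)
  (N_gt0 : (0 < N)%N) (l_ndvd_N : ~~ (l %| N)%N)
  (psi_char : dirichlet_character N psi)
  (L_Qlbar : is_Qlbar l abs) (F_residue : is_residue abs red)
  (zeta_prim : l.-primitive_root zeta)
  (f_S : forall i, in_S iC l k N psi (f i) (a i))
  (f_eigen : forall i, normalized_eigen k N psi (a i))
  (rho_f : forall i, attached_rep l abs iota k N psi (a i) (rho i))
  (rhobar_f : forall i, ss_reduction abs red (rho i) (rhobar i))
  (big_image : forall i, image_contains_conj_SL2 l (rhobar i)) :
  forall gamma : 'M['F_l]_2, \det gamma = 1 ->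
  exists sigma : GQ,
    [/\ GalOver (Qadjoin zeta) sigma,
        forall i, conj_GL2 (rhobar i sigma) (Fl_mx F gamma) \/
                  conj_GL2 (rhobar i sigma) (- Fl_mx F gamma)
      & forall i, conj_GL2 (rhobar i (GQM sigma sigma))
                          (Fl_mx F (gamma *m gamma))].
Proof.
move=> gamma g1; have lch := residue_char l_prime L_Qlbar F_residue.
have fin i : is_rep (rhobar i) /\ exists X : seq algC,
    forall s t : GQ, {in X, s =1 t} -> rhobar i s = rhobar i t.
  have [rep_i cont_i _ _] := rho_f i.
  exact (reduction_finite L_Qlbar F_residue rep_i cont_i (rhobar_f i)).
have rep i : is_rep (rhobar i) by have [] := fin i.
have [X XP] := choice (fun i => proj2 (fin i)).
pose Y := zeta :: flatten [seq X i | i <- enum 'I_s].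
have YP i (u t : GQ) : {in Y, u =1 t} -> rhobar i u = rhobar i t.
  move=> ut; apply: XP => x Xx; apply: ut; rewrite in_cons; apply/orP; right.
  by apply/flatten_mapP; exists i; rewrite ?mem_enum.
have [gT [G [theta [thetaG theta_surj thetaM theta_eq]]]] := finite_quotient Y.
have [r rE] := choice (fun i =>
  descend_rep thetaG theta_surj thetaM theta_eq (rep i) (YP i)).
have big i : exists2 h, h \is a GRing.unit & contains_SL2 l (r i) h.
  have [h hu hP] := big_image i; exists h => // A A1.
  by have [u eu] := hP A A1; exists (theta u); rewrite ?rE.
have [x x_der xP] := common_element l_prime l_ge5 lch big g1.
have [sigma sE] := theta_surj _ (fintype.subsetP (der_sub 1 G) _ x_der).
have sigmaP i : exists2 h, h \is a GRing.unit &
    eqpm (rhobar i sigma) (h * Fl_mx F gamma * h^-1).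
  by have [h hu] := xP i; rewrite -sE rE; exists h.
exists sigma; split.
- have sz : sigma zeta = zeta.
    apply: (der_fixes_root zeta_prim _ thetaG theta_surj thetaM theta_eq).
      exact: mem_head.
    by rewrite sE.
  move=> _ [p _ <-]; rewrite -horner_map sz; congr (_.[_]).
  by rewrite -map_poly_comp; apply: eq_map_poly => q /=; rewrite fmorph_rat.
- move=> i; have [h hu [->|->]] := sigmaP i; [left|right]; exists h => //.
  by rewrite -conjN.
- move=> i; have [h hu e] := sigmaP i; exists h => //.
  have [_ ->] := rep i; rewrite !mulmxE Fl_mxM // -[RHS]conjM //.
  by case: e => ->; rewrite ?mulrNN.
Qed.
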